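(* Let $\Bbbk$ be an algebraically closed field with $\mathrm{char}(\Bbbk)\neq 2$. Let $A,B$ be finite dimensional superalgebras over $\Bbbk$ (unital associative $\mathbb{Z}_2$-graded algebras) and let $F:\mathcal{D}^b(A\text{-gmod})\to\mathcal{D}^b(B\text{-gmod})$ be a strong triangulated $\mathbf{\Pi}$-equivalence which admits a strong triangulated $\mathbf{\Pi}$-functor as inverse. Then there are algebra isomorphisms $$s\mathcal{Z}(A)\cong s\mathcal{Z}(B)\quad\text{and}\quad s\mathcal{Z}(A)\oplus a\mathcal{Z}(A)\cong s\mathcal{Z}(B)\oplus a\mathcal{Z}(B).$$
   Context: $A\text{-gmod}$ is the category of finite dimensional $\mathbb{Z}_2$-graded left $A$-modules with degree-preserving $A$-linear maps. $\mathbf{\Pi}$ is the parity shift functor: $(\mathbf{\Pi}M)_{i}=M_{i+\bar1}$ with unchanged underlying module and maps; $\mathbf{\Pi}^2=\mathrm{Id}$. It is exact and induces a functor on $\mathcal{D}^b(A\text{-gmod})$ with the same notation. A $\mathbf{\Pi}$-functor is a ($\Bbbk$-linear, additive) functor $F$ from $\mathcal{D}^b(A\text{-gmod})$ to $\mathcal{D}^b(B\text{-gmod})$ together with a natural isomorphism $\xi^F:\mathbf{\Pi}\circ F\Rightarrow F\circ\mathbf{\Pi}$ such that $\xi^F_{\mathbf{\Pi}}\circ\mathbf{\Pi}(\xi^F)$ is the identity of $F$ (using $\mathbf{\Pi}^2=\mathrm{Id}$). A $\mathbf{\Pi}$-equivalence is a $\mathbf{\Pi}$-functor that is an equivalence.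 A triangulated equivalence $F$ is strong if both $F({}_AA)$ and $F^{-1}({}_BB)$ are quasi-isomorphic to complexes concentrated in one (cohomological) degree. The super centre $s\mathcal{Z}(A)$ is the subalgebra of $A$ spanned by homogeneous $x$ with $xy=(-1)^{\partial x\,\partial y}yx$ for all homogeneous $y\in A$. The anti centre $a\mathcal{Z}(A)$ is the subspace of $A$ spanned by homogeneous $x$ with $xy=(-1)^{(\partial x+1)\partial y}yx$ for all homogeneous $y\in A$. Products (in $A$) of two elements of $s\mathcal{Z}(A)$ or of two elements of $a\mathcal{Z}(A)$ lie in $s\mathcal{Z}(A)$, and products of an element of one with an element of the other lie in $a\mathcal{Z}(A)$. The external direct sum $s\mathcal{Z}(A)\oplus a\mathcal{Z}(A)$ is the algebra with product $(s,t)(s',t')=(ss'+tt',\,st'+ts')$. *)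

(* Defs.v *)
(* Library: Mathematical Components. *)
From HB Require Import structures.
From Stdlib Require Import Relation_Operators.
From mathcomp Require Import all_boot all_order all_algebra.
From mathcomp Require Import zify.

Set Implicit Arguments.
Unset Strict Implicit.
Unset Printing Implicit Defensive.

#[local] Obligation Tactic := idtac.

Import GRing.Theory.
Local Open Scope ring_scope.

(* Z_2 is bool with addition (+): false is degree 0, true is degree 1.        *)
Definition is_grading (k : fieldType) (V : vectType k)
    (gr : bool -> {vspace V}) : Prop :=
  (gr false + gr true = fullv)%VS /\ (gr false :&: gr true = 0)%VS.

(* The structure falgType is not used for the underlying algebra because it   *)
(* excludes the zero algebra.                                                 *)
Record superalg (k : fieldType) := Superalg {
  salg :> vectType k;
  smul : salg -> salg -> salg;
  sone : salg;
  sgr : bool -> {vspace salg};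
  smul_linl : forall y, linear (fun x => smul x y);
  smul_linr : forall x, linear (smul x);
  smulA : forall x y z, smul x (smul y z) = smul (smul x y) z;
  smul1l : forall x, smul sone x = x;
  smul1r : forall x, smul x sone = x;
  sgr_dec : is_grading sgr;
  sgr1 : sone \in sgr false;
  sgrM : forall i j x y, x \in sgr i -> y \in sgr j -> smul x y \in sgr (i (+) j)
}.
Arguments sone {k} s.

Local Notation "x *s y" := (smul x y) (at level 40, left associativity).

Section Centres.
Variables (k : fieldType) (A : superalg k).

Definition span_of (P : A -> Prop) (z : A) : Prop :=
  exists s : seq A, (forall x, x \in s -> P x) /\ z \in <<s>>%VS.

Definition super_commuting (e : bool) (x : A) : Prop :=
  exists2 i, x \in sgr A i &
    forall j y, y \in sgr A j -> x *s y = (-1) ^+ ((i (+) e) && j) *: (y *s x).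

Definition super_centre : A -> Prop := span_of (super_commuting false).
Definition anti_centre : A -> Prop := span_of (super_commuting true).

Definition centre_sum (p : A * A) : Prop :=
  super_centre p.1 /\ anti_centre p.2.

Definition centre_sum_one : A * A := (sone A, 0).

Definition centre_sum_mul (p q : A * A) : A * A :=
  (p.1 *s q.1 + p.2 *s q.2, p.1 *s q.2 + p.2 *s q.1).

End Centres.

(* P and Q carve out subspaces of V and W, closed under the products and      *)
(* containing the units.  Every linear map between these subspaces is the     *)
(* restriction of a linear map V -> W.                                        *)
Definition algebras_isomorphic (k : fieldType) (V W : vectType k)
    (P : V -> Prop) (oneV : V) (mulV : V -> V -> V)
    (Q : W -> Prop) (oneW : W) (mulW : W -> W -> W) : Prop :=
  exists f : 'Hom(V, W),
    (forall x, P x -> Q (f x)) /\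
    (forall x y, P x -> P y -> f x = f y -> x = y) /\
    (forall y, Q y -> exists2 x, P x & f x = y) /\
    f oneV = oneW /\
    (forall x y, P x -> P y -> f (mulV x y) = mulW (f x) (f y)).

Section GradedModules.
Variables (k : fieldType) (A : superalg k).

Record gmod := Gmod {
  gcar :> vectType k;
  gact : A -> gcar -> gcar;
  ggr : bool -> {vspace gcar};
  gact_linl : forall v : gcar, linear (fun a : A => gact a v);
  gact_linr : forall a : A, linear (gact a);
  gact1 : forall v : gcar, gact (sone A) v = v;
  gactM : forall (a b : A) (v : gcar), gact (a *s b) v = gact a (gact b v);
  ggr_dec : is_grading ggr;
  gactG : forall i j (a : A) (v : gcar),
    a \in sgr A i -> v \in ggr j -> gact a v \in ggr (i (+) j)
}.

Lemma gact0 (M : gmod) a : gact a (0 : M) = 0.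
Proof. by have := gact_linr a (-1) (0 : M) 0; rewrite scaler0 addr0 scaleN1r addNr. Qed.

Lemma gactD (M : gmod) a (u v : M) : gact a (u + v) = gact a u + gact a v.
Proof. by have := gact_linr a 1 u v; rewrite !scale1r. Qed.

Lemma gactZ (M : gmod) a c (v : M) : gact a (c *: v) = c *: gact a v.
Proof. by have := gact_linr a c v 0; rewrite gact0 !addr0. Qed.

Lemma gactN (M : gmod) a (v : M) : gact a (- v) = - gact a v.
Proof. by rewrite -scaleN1r gactZ scaleN1r. Qed.

Record gmap (M N : gmod) := Gmap {
  gfun :> 'Hom(M, N);
  gmap_act : forall (a : A) (v : M), gfun (gact a v) = gact a (gfun v);
  gmap_gr : forall i (v : M), v \in ggr M i -> gfun v \in ggr N i
}.

Program Definition gid (M : gmod) : gmap M M := @Gmap M M \1%VF _ _.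
Next Obligation. by move=> M a v; rewrite !id_lfunE. Qed.
Next Obligation. by move=> M i v; rewrite id_lfunE. Qed.

Program Definition gcomp (M N P : gmod) (g : gmap N P) (f : gmap M N) :
  gmap M P := @Gmap M P (g \o f)%VF _ _.
Next Obligation. by move=> M N P g f a v; rewrite !comp_lfunE !gmap_act. Qed.
Next Obligation. by move=> M N P g f i v; rewrite comp_lfunE => /gmap_gr/gmap_gr. Qed.

Program Definition gzero (M N : gmod) : gmap M N := @Gmap M N 0 _ _.
Next Obligation.
by move=> M N a v; rewrite !zero_lfunE gact0.
Qed.
Next Obligation. by move=> M N i v _; rewrite zero_lfunE mem0v. Qed.

Program Definition gadd (M N : gmod) (f g : gmap M N) : gmap M N :=
  @Gmap M N (gfun f + gfun g) _ _.
Next Obligation.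
by move=> M N f g a v; rewrite !add_lfunE !gmap_act gactD.
Qed.
Next Obligation. by move=> M N f g i v h; rewrite add_lfunE memvD ?gmap_gr. Qed.

Program Definition gscale (M N : gmod) (c : k) (f : gmap M N) : gmap M N :=
  @Gmap M N (c *: gfun f) _ _.
Next Obligation.
by move=> M N c f a v; rewrite !scale_lfunE !gmap_act gactZ.
Qed.
Next Obligation. by move=> M N c f i v h; rewrite scale_lfunE memvZ ?gmap_gr. Qed.

Program Definition gparity (M : gmod) : gmod :=
  @Gmod M (@gact M) (fun i => ggr M (~~ i)) _ _ _ _ _ _.
Next Obligation. by move=> M; apply: gact_linl. Qed.
Next Obligation. by move=> M; apply: gact_linr. Qed.
Next Obligation. by move=> M; apply: gact1. Qed.
Next Obligation. by move=> M; apply: gactM. Qed.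
Next Obligation.
by move=> M; have [h1 h2] := ggr_dec M; split; rewrite /= 1?addvC 1?capvC.
Qed.
Next Obligation. by move=> M i j a v /gactG h/h; rewrite addbN. Qed.

Program Definition gparity_map (M N : gmod) (f : gmap M N) :
  gmap (gparity M) (gparity N) := @Gmap (gparity M) (gparity N) (gfun f) _ _.
Next Obligation. by move=> M N f a v; exact: (gmap_act f a v). Qed.
Next Obligation. by move=> M N f i v; exact: (@gmap_gr _ _ f (~~ i) v). Qed.

Program Definition gparity_invol (M : gmod) : gmap (gparity (gparity M)) M :=
  @Gmap (gparity (gparity M)) M \1%VF _ _.
Next Obligation. by move=> M a v; rewrite !id_lfunE. Qed.
Next Obligation. by move=> M i v /=; rewrite id_lfunE negbK. Qed.

Program Definition gzmod : gmod :=
  @Gmod 'rV[k]_0 (fun _ v => v) (fun _ => 0%VS) _ _ _ _ _ _.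
Next Obligation. by move=> v c a b; rewrite [LHS]thinmx0 [RHS]thinmx0. Qed.
Next Obligation. by []. Qed.
Next Obligation. by []. Qed.
Next Obligation. by []. Qed.
Next Obligation.
by split; apply/vspaceP => v; rewrite [v]thinmx0 !mem0v.
Qed.
Next Obligation. by []. Qed.

Program Definition gregular : gmod :=
  @Gmod A (fun a x => a *s x) (sgr A) _ _ _ _ _ _.
Next Obligation. exact: smul_linl. Qed.
Next Obligation. exact: smul_linr. Qed.
Next Obligation. exact: smul1l. Qed.
Next Obligation. by move=> a b v; exact/esym/smulA. Qed.
Next Obligation. exact: sgr_dec. Qed.
Next Obligation. exact: sgrM. Qed.

Definition lfst (V W : vectType k) : 'Hom((V * W)%type, V) :=
  linfun (fst : V * W -> V).
Definition lsnd (V W : vectType k) : 'Hom((V * W)%type, W) :=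
  linfun (snd : V * W -> W).

Definition pair_fun (U V W : vectType k) (f : 'Hom(U, V)) (g : 'Hom(U, W))
  (u : U) : V * W := (f u, g u).

Fact pair_fun_linear (U V W : vectType k) (f : 'Hom(U, V)) (g : 'Hom(U, W)) :
  linear (pair_fun f g).
Proof. by move=> c u v; rewrite /pair_fun !linearP. Qed.

HB.instance Definition _ (U V W : vectType k) f g :=
  GRing.isLinear.Build k U (V * W)%type _ (@pair_fun U V W f g)
    (pair_fun_linear f g).

Definition lpair (U V W : vectType k) (f : 'Hom(U, V)) (g : 'Hom(U, W)) :
  'Hom(U, (V * W)%type) := linfun (pair_fun f g).

Lemma lfstE (V W : vectType k) (p : V * W) : lfst V W p = p.1.
Proof. exact: lfunE. Qed.

Lemma lsndE (V W : vectType k) (p : V * W) : lsnd V W p = p.2.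
Proof. exact: lfunE. Qed.

Lemma lpairE (U V W : vectType k) (f : 'Hom(U, V)) (g : 'Hom(U, W)) u :
  lpair f g u = (f u, g u).
Proof. exact: lfunE. Qed.

Definition vprod (V W : vectType k) (U1 : {vspace V}) (U2 : {vspace W}) :
  {vspace (V * W)%type} := (lfst V W @^-1: U1 :&: lsnd V W @^-1: U2)%VS.

Lemma mem_vprod (V W : vectType k) (U1 : {vspace V}) (U2 : {vspace W}) p :
  (p \in vprod U1 U2) = (p.1 \in U1) && (p.2 \in U2).
Proof. by rewrite memv_cap -!memv_preim lfstE lsndE. Qed.

Lemma is_gradingP (V : vectType k) (gr : bool -> {vspace V}) :
  is_grading gr <->
  (forall v, exists v0 v1, [/\ v0 \in gr false, v1 \in gr true & v = v0 + v1])
  /\ (forall v, v \in gr false -> v \in gr true -> v = 0).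
Proof.
split=> [[h1 h2]|[h1 h2]]; split.
- move=> v; have := memvf v; rewrite -h1 => /memv_addP[v0 h [v1 h' ->]].
  by exists v0, v1.
- move=> v v0 v1; apply/eqP; rewrite -memv0 -h2.
  by rewrite memv_cap v0.
- apply/vspaceP => v; rewrite memvf; have [v0 [v1 [hv0 hv1 ->]]] := h1 v.
  exact: memv_add.
- apply/vspaceP => v; rewrite memv_cap memv0; apply/andP/eqP => [[]|->].
    exact: h2.
  by rewrite !mem0v.
Qed.

Program Definition gsum (M N : gmod) : gmod :=
  @Gmod (M * N)%type (fun a p => (gact a p.1, gact a p.2))
    (fun i => vprod (ggr M i) (ggr N i)) _ _ _ _ _ _.
Next Obligation.
move=> M N [v w] c a b /=.
by rewrite (gact_linl (g := M)) (gact_linl (g := N)).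
Qed.
Next Obligation.
move=> M N a c [v w] [v' w'] /=.
by rewrite (gact_linr (g := M)) (gact_linr (g := N)).
Qed.
Next Obligation. by move=> M N [v w]; rewrite /= !gact1. Qed.
Next Obligation. by move=> M N a b [v w]; rewrite /= !gactM. Qed.
Next Obligation.
move=> M N; apply/is_gradingP.
have /is_gradingP[hM1 hM2] := ggr_dec M; have /is_gradingP[hN1 hN2] := ggr_dec N.
split=> [[v w]|[v w]].
- have [v0 [v1 [hv0 hv1 ->]]] := hM1 v; have [w0 [w1 [hw0 hw1 ->]]] := hN1 w.
  by exists (v0, w0), (v1, w1); rewrite !mem_vprod; split=> //=; apply/andP.
- rewrite !mem_vprod /= => /andP[hv0 hw0] /andP[hv1 hw1].
  by rewrite (hM2 v) // (hN2 w).
Qed.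
Next Obligation.
move=> M N i j a [v w] ha; rewrite !mem_vprod /= => /andP[hv hw].
by rewrite !gactG.
Qed.

Program Definition gfst (M N : gmod) : gmap (gsum M N) M :=
  @Gmap (gsum M N) M (lfst M N) _ _.
Next Obligation. by move=> M N a p; rewrite !lfstE. Qed.
Next Obligation. by move=> M N i p; rewrite mem_vprod lfstE => /andP[]. Qed.

Program Definition gsnd (M N : gmod) : gmap (gsum M N) N :=
  @Gmap (gsum M N) N (lsnd M N) _ _.
Next Obligation. by move=> M N a p; rewrite !lsndE. Qed.
Next Obligation. by move=> M N i p; rewrite mem_vprod lsndE => /andP[]. Qed.

Program Definition gpair (L M N : gmod) (f : gmap L M) (g : gmap L N) :
  gmap L (gsum M N) := @Gmap L (gsum M N) (lpair f g) _ _.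
Next Obligation. by move=> L M N f g a v; rewrite !lpairE !gmap_act. Qed.
Next Obligation.
by move=> L M N f g i v hv; rewrite mem_vprod lpairE /= !gmap_gr.
Qed.

End GradedModules.

Section Complexes.
Variables (k : fieldType) (A : superalg k).

Record cpx := Cpx {
  cob :> int -> gmod A;
  cd : forall n, gmap (cob n) (cob (n + 1));
  cdd : forall n (x : cob n), cd (n + 1) (cd n x) = 0;
  cbounded : exists b : int,
    forall n, n < - b \/ b < n -> forall x : cob n, x = 0
}.

Record cmap (X Y : cpx) := Cmap {
  cfun :> forall n, gmap (X n) (Y n);
  cfun_d : forall n (x : X n), cfun (n + 1) (cd X n x) = cd Y n (cfun n x)
}.

Definition ceq (X Y : cpx) (f g : cmap X Y) : Prop :=
  forall n (x : X n), f n x = g n x.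

Program Definition cid (X : cpx) : cmap X X :=
  @Cmap X X (fun n => gid (X n)) _.
Next Obligation. by move=> X n x; rewrite /= !id_lfunE. Qed.

Program Definition ccomp (X Y Z : cpx) (g : cmap Y Z) (f : cmap X Y) :
  cmap X Z := @Cmap X Z (fun n => gcomp (g n) (f n)) _.
Next Obligation. by move=> X Y Z g f n x; rewrite /= !comp_lfunE !cfun_d. Qed.

Program Definition czero (X Y : cpx) : cmap X Y :=
  @Cmap X Y (fun n => gzero (X n) (Y n)) _.
Next Obligation. by move=> X Y n x; rewrite /= !zero_lfunE linear0. Qed.

Program Definition cadd (X Y : cpx) (f g : cmap X Y) : cmap X Y :=
  @Cmap X Y (fun n => gadd (f n) (g n)) _.
Next Obligation. by move=> X Y f g n x; rewrite /= !add_lfunE !cfun_d linearD. Qed.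

Program Definition cscale (X Y : cpx) (c : k) (f : cmap X Y) : cmap X Y :=
  @Cmap X Y (fun n => gscale c (f n)) _.
Next Obligation. by move=> X Y c f n x; rewrite /= !scale_lfunE cfun_d linearZ. Qed.

(* H^(n+1)(f) is injective and surjective for all n, where                    *)
(* H^(n+1)(X) = ker (cd X (n + 1)) / im (cd X n).                             *)
Definition qis (X Y : cpx) (f : cmap X Y) : Prop :=
  forall n : int,
    (forall x : X (n + 1), cd X (n + 1) x = 0 ->
       (exists y : Y n, f (n + 1) x = cd Y n y) ->
       exists x' : X n, x = cd X n x') /\
    (forall y : Y (n + 1), cd Y (n + 1) y = 0 ->
       exists2 x : X (n + 1), cd X (n + 1) x = 0 &
         exists y' : Y n, y - f (n + 1) x = cd Y n y').

(* D^b(A-gmod): the localisation of the k-linear category of bounded          *)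
(* complexes at the quasi-isomorphisms, given by generators (dhom) and        *)
(* relations (deq); morphisms are classes of dhom modulo deq.  Here the sum   *)
(* and the scalar multiplication are part of the generators.  This gives the  *)
(* same category as the localisation without linear structure, since the      *)
(* latter is itself k-linear (calculus of fractions in the homotopy           *)
(* category) and the localisation functor is k-linear.                        *)
Inductive dhom : cpx -> cpx -> Type :=
| Dmap X Y (f : cmap X Y) : dhom X Y
| Dinv X Y (s : cmap X Y) : qis s -> dhom Y X
| Dcomp X Y Z : dhom Y Z -> dhom X Y -> dhom X Z
| Dadd X Y : dhom X Y -> dhom X Y -> dhom X Y
| Dscale X Y : k -> dhom X Y -> dhom X Y.

Definition did (X : cpx) : dhom X X := Dmap (cid X).

Inductive deq : forall X Y : cpx, dhom X Y -> dhom X Y -> Prop :=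
| Deq_refl X Y (f : dhom X Y) : deq f f
| Deq_sym X Y (f g : dhom X Y) : deq f g -> deq g f
| Deq_trans X Y (f g h : dhom X Y) : deq f g -> deq g h -> deq f h
| Deq_comp X Y Z (g g' : dhom Y Z) (f f' : dhom X Y) :
    deq g g' -> deq f f' -> deq (Dcomp g f) (Dcomp g' f')
| Deq_add X Y (f f' g g' : dhom X Y) :
    deq f f' -> deq g g' -> deq (Dadd f g) (Dadd f' g')
| Deq_scale X Y c (f f' : dhom X Y) :
    deq f f' -> deq (Dscale c f) (Dscale c f')
  (* category *)
| Deq_compA X Y Z T (h : dhom Z T) (g : dhom Y Z) (f : dhom X Y) :
    deq (Dcomp h (Dcomp g f)) (Dcomp (Dcomp h g) f)
| Deq_idl X Y (f : dhom X Y) : deq (Dcomp (did Y) f) f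
| Deq_idr X Y (f : dhom X Y) : deq (Dcomp f (did X)) f
  (* k-modules of morphisms, bilinear composition *)
| Deq_addC X Y (f g : dhom X Y) : deq (Dadd f g) (Dadd g f)
| Deq_addA X Y (f g h : dhom X Y) :
    deq (Dadd f (Dadd g h)) (Dadd (Dadd f g) h)
| Deq_scale0 X Y (f : dhom X Y) : deq (Dscale 0 f) (Dmap (czero X Y))
| Deq_scale1 X Y (f : dhom X Y) : deq (Dscale 1 f) f
| Deq_scaleA X Y c d (f : dhom X Y) :
    deq (Dscale c (Dscale d f)) (Dscale (c * d) f)
| Deq_scaleDl X Y c d (f : dhom X Y) :
    deq (Dscale (c + d) f) (Dadd (Dscale c f) (Dscale d f))
| Deq_scaleDr X Y c (f g : dhom X Y) :
    deq (Dscale c (Dadd f g)) (Dadd (Dscale c f) (Dscale c g))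
| Deq_compDl X Y Z (g g' : dhom Y Z) (f : dhom X Y) :
    deq (Dcomp (Dadd g g') f) (Dadd (Dcomp g f) (Dcomp g' f))
| Deq_compDr X Y Z (g : dhom Y Z) (f f' : dhom X Y) :
    deq (Dcomp g (Dadd f f')) (Dadd (Dcomp g f) (Dcomp g f'))
| Deq_compZl X Y Z c (g : dhom Y Z) (f : dhom X Y) :
    deq (Dcomp (Dscale c g) f) (Dscale c (Dcomp g f))
| Deq_compZr X Y Z c (g : dhom Y Z) (f : dhom X Y) :
    deq (Dcomp g (Dscale c f)) (Dscale c (Dcomp g f))
  (* Dmap is a k-linear functor *)
| Deq_map X Y (f g : cmap X Y) : ceq f g -> deq (Dmap f) (Dmap g)
| Deq_mapM X Y Z (g : cmap Y Z) (f : cmap X Y) :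
    deq (Dmap (ccomp g f)) (Dcomp (Dmap g) (Dmap f))
| Deq_mapD X Y (f g : cmap X Y) :
    deq (Dmap (cadd f g)) (Dadd (Dmap f) (Dmap g))
| Deq_mapZ X Y c (f : cmap X Y) : deq (Dmap (cscale c f)) (Dscale c (Dmap f))
  (* quasi-isomorphisms become invertible *)
| Deq_invl X Y (s : cmap X Y) (qs : qis s) :
    deq (Dcomp (Dinv qs) (Dmap s)) (did X)
| Deq_invr X Y (s : cmap X Y) (qs : qis s) :
    deq (Dcomp (Dmap s) (Dinv qs)) (did Y).

Definition is_iso (X Y : cpx) (f : dhom X Y) : Prop :=
  exists g : dhom Y X, deq (Dcomp g f) (did X) /\ deq (Dcomp f g) (did Y).

Program Definition cshift (X : cpx) : cpx :=
  @Cpx (fun n => X (n + 1)) (fun n => gscale (-1) (cd X (n + 1))) _ _.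
Next Obligation.
by move=> X n x; rewrite /= !scale_lfunE linearZ /= cdd !scaler0.
Qed.
Next Obligation.
move=> X; have [b hb] := cbounded X.
by exists (b + 1) => n hn; apply: hb; lia.
Qed.

Program Definition cshift_map (X Y : cpx) (f : cmap X Y) :
  cmap (cshift X) (cshift Y) :=
  @Cmap (cshift X) (cshift Y) (fun n => f (n + 1)) _.
Next Obligation.
by move=> X Y f n x; rewrite /= !scale_lfunE linearZ /= cfun_d.
Qed.

Program Definition cparity (X : cpx) : cpx :=
  @Cpx (fun n => gparity (X n)) (fun n => gparity_map (cd X n)) _ _.
Next Obligation. by move=> X n x; exact: (@cdd X n x). Qed.
Next Obligation. by move=> X; apply: cbounded. Qed.

Program Definition cparity_map (X Y : cpx) (f : cmap X Y) :
  cmap (cparity X) (cparity Y) :=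
  @Cmap (cparity X) (cparity Y) (fun n => gparity_map (f n)) _.
Next Obligation. by move=> X Y f n x; exact: (@cfun_d X Y f n x). Qed.

Program Definition cparity_invol (X : cpx) : cmap (cparity (cparity X)) X :=
  @Cmap (cparity (cparity X)) X (fun n => gparity_invol (X n)) _.
Next Obligation. by move=> X n x; rewrite /= !id_lfunE. Qed.

(* The module M as a complex concentrated in degree 0. *)
Definition cstalk_ob (M : gmod A) (n : int) : gmod A :=
  if n == 0 then M else gzmod A.

Program Definition cstalk (M : gmod A) : cpx :=
  @Cpx (cstalk_ob M) (fun n => gzero _ _) _ _.
Next Obligation. by move=> M n x; rewrite /= zero_lfunE. Qed.
Next Obligation.
move=> M; exists 0 => n hn; rewrite /cstalk_ob.
have /negPf-> : n != 0 by lia.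
by move=> x; rewrite [x]thinmx0.
Qed.

(* (x, y) |-> (- d x, f x + d y) *)
Definition ccone_d (X Y : cpx) (f : cmap X Y) (n : int) :
    gmap (gsum (X (n + 1)) (Y n)) (gsum (X (n + 1 + 1)) (Y (n + 1))) :=
  gpair (gscale (-1) (gcomp (cd X (n + 1)) (gfst _ _)))
        (gadd (gcomp (f (n + 1)) (gfst _ _)) (gcomp (cd Y n) (gsnd _ _))).

Lemma ccone_dE (X Y : cpx) (f : cmap X Y) (n : int)
    (p : gsum (X (n + 1)) (Y n)) :
  ccone_d f n p = (- cd X (n + 1) p.1, f (n + 1) p.1 + cd Y n p.2).
Proof.
rewrite /= lpairE scale_lfunE scaleN1r add_lfunE !comp_lfunE.
by rewrite lfstE lsndE.
Qed.

Program Definition ccone (X Y : cpx) (f : cmap X Y) : cpx :=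
  @Cpx (fun n => gsum (X (n + 1)) (Y n)) (ccone_d f) _ _.
Next Obligation.
move=> X Y f n p; rewrite !ccone_dE /= linearN /= cdd !oppr0.
by rewrite linearD linearN /= cdd addr0 cfun_d addNr.
Qed.
Next Obligation.
move=> X Y f; have [b hb] := cbounded X; have [c hc] := cbounded Y.
exists (`|b| + `|c| + 1) => n hn [x y].
by rewrite (hb _ _ x) ?(hc _ _ y) //; lia.
Qed.

Program Definition ccone_in (X Y : cpx) (f : cmap X Y) : cmap Y (ccone f) :=
  @Cmap Y (ccone f) (fun n => gpair (gzero (Y n) (X (n + 1))) (gid (Y n))) _.
Next Obligation.
move=> X Y f n y; rewrite [RHS]ccone_dE /= !lpairE !zero_lfunE !id_lfunE /=.
by rewrite !linear0 add0r.
Qed.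

Program Definition ccone_out (X Y : cpx) (f : cmap X Y) :
  cmap (ccone f) (cshift X) :=
  @Cmap (ccone f) (cshift X) (fun n => gfst (X (n + 1)) (Y n)) _.
Next Obligation.
move=> X Y f n p; rewrite [cd (ccone f) n p]ccone_dE /= !lfstE /=.
by rewrite scale_lfunE scaleN1r.
Qed.

Definition quasi_isomorphic : cpx -> cpx -> Prop :=
  clos_refl_sym_trans cpx (fun X Y => exists f : cmap X Y, qis f).

Definition quasi_concentrated (X : cpx) : Prop :=
  exists2 Y : cpx, quasi_isomorphic X Y &
    exists n : int, forall m : int, m != n -> forall y : Y m, y = 0.

End Complexes.

(* k-linear functors D^b(A-gmod) -> D^b(B-gmod). *)
Record dfunctor (k : fieldType) (A B : superalg k) := Dfunctor {
  fob :> cpx A -> cpx B;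
  fmap : forall X Y, dhom X Y -> dhom (fob X) (fob Y);
  fmap_eq : forall X Y (f g : dhom X Y), deq f g -> deq (fmap f) (fmap g);
  fmap_id : forall X, deq (fmap (did X)) (did (fob X));
  fmapM : forall X Y Z (g : dhom Y Z) (f : dhom X Y),
    deq (fmap (Dcomp g f)) (Dcomp (fmap g) (fmap f));
  fmapD : forall X Y (f g : dhom X Y),
    deq (fmap (Dadd f g)) (Dadd (fmap f) (fmap g));
  fmapZ : forall X Y c (f : dhom X Y),
    deq (fmap (Dscale c f)) (Dscale c (fmap f))
}.

Section Functors.
Variable k : fieldType.

Program Definition dfid (A : superalg k) : dfunctor A A :=
  @Dfunctor k A A (fun X => X) (fun X Y f => f) _ _ _ _ _.
Next Obligation. by []. Qed.
Next Obligation. by move=> *; apply: Deq_refl. Qed.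
Next Obligation. by move=> *; apply: Deq_refl. Qed.
Next Obligation. by move=> *; apply: Deq_refl. Qed.
Next Obligation. by move=> *; apply: Deq_refl. Qed.

Program Definition dfcomp (A B C : superalg k)
    (G : dfunctor B C) (F : dfunctor A B) : dfunctor A C :=
  @Dfunctor k A C (fun X => G (F X)) (fun X Y f => fmap G (fmap F f)) _ _ _ _ _.
Next Obligation. by move=> A B C G F X Y f g h; do 2!apply: fmap_eq. Qed.
Next Obligation.
move=> A B C G F X; apply: Deq_trans (fmap_id G _); apply: fmap_eq.
exact: fmap_id.
Qed.
Next Obligation.
move=> A B C G F X Y Z g f; apply: Deq_trans (fmapM G _ _); apply: fmap_eq.
exact: fmapM.
Qed.
Next Obligation.
move=> A B C G F X Y f g; apply: Deq_trans (fmapD G _ _); apply: fmap_eq.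
exact: fmapD.
Qed.
Next Obligation.
move=> A B C G F X Y c f; apply: Deq_trans (fmapZ G _ _); apply: fmap_eq.
exact: fmapZ.
Qed.

(* A k-linear functor on complexes which preserves quasi-isomorphisms induces *)
(* a functor on derived categories.                                           *)
Section Induced.
Variables (A B : superalg k) (T : cpx A -> cpx B).
Variable Tm : forall X Y, cmap X Y -> cmap (T X) (T Y).
Hypothesis Tqis : forall X Y (f : cmap X Y), qis f -> qis (Tm f).
Hypothesis Teq : forall X Y (f g : cmap X Y), ceq f g -> ceq (Tm f) (Tm g).
Hypothesis T1 : forall X, ceq (Tm (cid X)) (cid (T X)).
Hypothesis TM : forall X Y Z (g : cmap Y Z) (f : cmap X Y),
  ceq (Tm (ccomp g f)) (ccomp (Tm g) (Tm f)).
Hypothesis T0 : forall X Y, ceq (Tm (czero X Y)) (czero (T X) (T Y)).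
Hypothesis TD : forall X Y (f g : cmap X Y),
  ceq (Tm (cadd f g)) (cadd (Tm f) (Tm g)).
Hypothesis TZ : forall X Y c (f : cmap X Y),
  ceq (Tm (cscale c f)) (cscale c (Tm f)).

Fixpoint induced_map X Y (f : dhom X Y) : dhom (T X) (T Y) :=
  match f with
  | Dmap _ _ f => Dmap (Tm f)
  | Dinv _ _ s qs => Dinv (Tqis qs)
  | Dcomp _ _ _ g f => Dcomp (induced_map g) (induced_map f)
  | Dadd _ _ f g => Dadd (induced_map f) (induced_map g)
  | Dscale _ _ c f => Dscale c (induced_map f)
  end.

Lemma induced_id X : deq (induced_map (did X)) (did (T X)).
Proof. exact/Deq_map/T1. Qed.

Lemma induced_eq X Y (f g : dhom X Y) :
  deq f g -> deq (induced_map f) (induced_map g).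
Proof.
elim=> {X Y f g} /=.
- by move=> *; apply: Deq_refl.
- by move=> *; apply: Deq_sym.
- by move=> X Y f g h _ h1 _ h2; apply: Deq_trans h1 h2.
- by move=> *; apply: Deq_comp.
- by move=> *; apply: Deq_add.
- by move=> *; apply: Deq_scale.
- by move=> *; apply: Deq_compA.
- move=> X Y f; apply: Deq_trans (Deq_idl _).
  exact: Deq_comp (induced_id _) (Deq_refl _).
- move=> X Y f; apply: Deq_trans (Deq_idr _).
  exact: Deq_comp (Deq_refl _) (induced_id _).
- by move=> *; apply: Deq_addC.
- by move=> *; apply: Deq_addA.
- move=> X Y f; apply: Deq_trans (Deq_scale0 _) _.
  exact/Deq_sym/Deq_map/T0.
- by move=> *; apply: Deq_scale1.
- by move=> *; apply: Deq_scaleA.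
- by move=> *; apply: Deq_scaleDl.
- by move=> *; apply: Deq_scaleDr.
- by move=> *; apply: Deq_compDl.
- by move=> *; apply: Deq_compDr.
- by move=> *; apply: Deq_compZl.
- by move=> *; apply: Deq_compZr.
- by move=> *; apply/Deq_map/Teq.
- move=> X Y Z g f; apply: Deq_trans (Deq_mapM _ _); exact/Deq_map/TM.
- move=> X Y f g; apply: Deq_trans (Deq_mapD _ _); exact/Deq_map/TD.
- move=> X Y c f; apply: Deq_trans (Deq_mapZ _ _); exact/Deq_map/TZ.
- move=> X Y s qs; apply: Deq_trans (Deq_invl _) _.
  exact/Deq_sym/induced_id.
- move=> X Y s qs; apply: Deq_trans (Deq_invr _) _.
  exact/Deq_sym/induced_id.
Qed.

Definition induced : dfunctor A B :=
  @Dfunctor k A B T induced_map induced_eq induced_id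
    (fun X Y Z g f => Deq_refl _) (fun X Y f g => Deq_refl _)
    (fun X Y c f => Deq_refl _).

End Induced.

Lemma cparity_qis (A : superalg k) (X Y : cpx A) (f : cmap X Y) :
  qis f -> qis (cparity_map f).
Proof. by []. Qed.

Lemma cshift_qis (A : superalg k) (X Y : cpx A) (f : cmap X Y) :
  qis f -> qis (cshift_map f).
Proof.
move=> hf n; have [hi hs] := hf (n + 1).
have hN (M N : gmod A) (g : gmap M N) v : gscale (-1) g v = - g v.
  by rewrite /= scale_lfunE scaleN1r.
split=> [x hx [y hy]|y hy].
- have [||x' hx'] := hi x.
  + by move/eqP: hx; rewrite hN oppr_eq0 => /eqP.
  + by exists (- y); rewrite [LHS]hy hN linearN.
  by exists (- x'); rewrite hN linearN /= opprK.
- have [|x hx [y' hy']] := hs y.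
    by move/eqP: hy; rewrite hN oppr_eq0 => /eqP.
  exists x; first by rewrite hN hx oppr0.
  by exists (- y'); rewrite hN linearN /= opprK.
Qed.

Definition parity (A : superalg k) : dfunctor A A.
Proof.
apply: (@induced A A (@cparity k A) (@cparity_map k A) (@cparity_qis A)).
all: by move=> *.
Defined.

Definition shift (A : superalg k) : dfunctor A A.
Proof.
apply: (@induced A A (@cshift k A) (@cshift_map k A) (@cshift_qis A)).
- by move=> X Y f g h n x; apply: h.
all: by move=> *.
Defined.

(* The identification of the square of the parity shift with the identity.    *)
Definition parity_invol (A : superalg k) (X : cpx A) :
  dhom (parity A (parity A X)) X := Dmap (cparity_invol X).

Record natiso (A B : superalg k) (F G : dfunctor A B) := Natiso {
  nt :> forall X, dhom (F X) (G X);
  nt_iso : forall X, is_iso (nt X);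
  nt_nat : forall X Y (f : dhom X Y),
    deq (Dcomp (nt Y) (fmap F f)) (Dcomp (fmap G f) (nt X))
}.

Definition distinguished (A : superalg k) (X Y Z : cpx A)
    (u : dhom X Y) (v : dhom Y Z) (w : dhom Z (shift A X)) : Prop :=
  exists (X' Y' : cpx A) (f : cmap X' Y')
         (a : dhom X X') (b : dhom Y Y') (c : dhom Z (ccone f)),
    [/\ is_iso a, is_iso b & is_iso c] /\
    [/\ deq (Dcomp b u) (Dcomp (Dmap f) a),
        deq (Dcomp c v) (Dcomp (Dmap (ccone_in f)) b)
      & deq (Dcomp (fmap (shift A) a) w) (Dcomp (Dmap (ccone_out f)) c)].

Record triangulated (A B : superalg k) (F : dfunctor A B) := Triangulated {
  tri_shift : natiso (dfcomp F (shift A)) (dfcomp (shift B) F);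
  tri_dist : forall (X Y Z : cpx A)
      (u : dhom X Y) (v : dhom Y Z) (w : dhom Z (shift A X)),
    distinguished u v w ->
    distinguished (fmap F u) (fmap F v) (Dcomp (tri_shift X) (fmap F w))
}.

Record pi_structure (A B : superalg k) (F : dfunctor A B) := Pi_structure {
  pi_xi : natiso (dfcomp (parity B) F) (dfcomp F (parity A));
  pi_xi_invol : forall X : cpx A,
    deq (Dcomp (fmap F (parity_invol X))
               (Dcomp (pi_xi (parity A X)) (fmap (parity B) (pi_xi X))))
        (parity_invol (F X))
}.

Record tri_pi_functor (A B : superalg k) := Tri_pi_functor {
  tpf :> dfunctor A B;
  tpf_tri : triangulated tpf;
  tpf_pi : pi_structure tpf
}.

Definition quasi_inverse (A B : superalg k)
    (F : dfunctor A B) (G : dfunctor B A) : Prop :=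
  inhabited (natiso (dfcomp G F) (dfid A)) /\
  inhabited (natiso (dfcomp F G) (dfid B)).

(* F is an equivalence, and it and its inverse are strong.  Quasi-inverses    *)
(* of F are isomorphic, so the choice of G does not matter.                   *)
Definition strong_equivalence (A B : superalg k) (F : dfunctor A B) : Prop :=
  exists G : dfunctor B A,
    [/\ quasi_inverse F G,
        quasi_concentrated (F (cstalk (gregular A)))
      & quasi_concentrated (G (cstalk (gregular B)))].

End Functors.

(* Main.v *)
(* A homogeneous x of degree i in the super centre (e = 0) or the anti centre
   (e = 1) of A defines maps v |-> (-1)^((i+e)|v|) x v from X to Pi^i X, natural
   in X in D^b(A-gmod).  Let F(A) be concentrated in degree n, let P be B placed
   in degree n and choose X with F(X) = P.  Since Hom(P, Pi^i P) = B_i, the image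
   under F of the map for x at X is right multiplication by some b in B_i, and
   naturality with respect to all X -> Pi^j X says that b lies in the same centre
   of B; the signs picked up by composition are the same on both sides, so
   x |-> b is multiplicative.
   If b = 0, then the map for x vanishes at X, so at A it composes to zero with
   every map X -> Pi^j A.  The functor F turns these into all maps from P to
   Pi^j F(A); as F(A) is a module in degree n, it is generated by their images,
   so the map for x at A vanishes and x = 0.  The quasi-inverse gives an injection
   in the other direction, so both are bijective by dimension. *)
Require Import Defs.
From HB Require Import structures.
From Stdlib Require Import Setoid Morphisms.
From mathcomp Require Import all_boot all_order all_algebra.
From mathcomp Require Import zify.

Set Implicit Arguments.
Unset Strict Implicit.
Unset Printing Implicit Defensive.

#[local] Obligation Tactic := idtac.

Import GRing.Theory Order.TTheory Num.Theory.
Local Open Scope ring_scope.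
Local Notation "x *s y" := (smul x y) (at level 40, left associativity).
Local Notation "f ≈ g" := (deq f g) (at level 70).
Local Notation "g ∘ f" := (Dcomp g f) (at level 40, left associativity).

(** * Calculus of morphisms in the derived category *)

#[local] Instance deq_equivalence k (A : superalg k) (X Y : cpx A) :
  Equivalence (@deq k A X Y).
Proof.
by split; [exact: Deq_refl|exact: Deq_sym|exact: Deq_trans].
Qed.

#[local] Hint Resolve Deq_refl : core.

#[local] Instance Dcomp_proper k (A : superalg k) (X Y Z : cpx A) :
  Proper (@deq k A Y Z ==> @deq k A X Y ==> @deq k A X Z) (@Dcomp k A X Y Z).
Proof. by move=> g g' hg f f' hf; apply: Deq_comp. Qed.

#[local] Instance Dadd_proper k (A : superalg k) (X Y : cpx A) :
  Proper (@deq k A X Y ==> @deq k A X Y ==> @deq k A X Y) (@Dadd k A X Y).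
Proof. by move=> g g' hg f f' hf; apply: Deq_add. Qed.

#[local] Instance Dscale_proper k (A : superalg k) (X Y : cpx A) c :
  Proper (@deq k A X Y ==> @deq k A X Y) (@Dscale k A X Y c).
Proof. by move=> f f' hf; apply: Deq_scale. Qed.

#[local] Instance fmap_proper k (A B : superalg k) (F : dfunctor A B) X Y :
  Proper (@deq k A X Y ==> @deq k B (F X) (F Y)) (@fmap k A B F X Y).
Proof. by move=> f f' hf; apply: fmap_eq. Qed.

Section Derived.
Variables (k : fieldType) (A : superalg k).
Implicit Types X Y Z : cpx A.

Definition dzero X Y : dhom X Y := Dmap (czero X Y).

Lemma dzero_scale X Y (f : dhom X Y) : dzero X Y ≈ Dscale 0 f.
Proof. exact/Deq_sym/Deq_scale0. Qed.

Lemma comp0d X Y Z (f : dhom X Y) : dzero Y Z ∘ f ≈ dzero X Z.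
Proof.
rewrite (dzero_scale (dzero Y Z)) Deq_compZl.
exact: Deq_scale0.
Qed.

Lemma compd0 X Y Z (f : dhom Y Z) : f ∘ dzero X Y ≈ dzero X Z.
Proof.
rewrite (dzero_scale (dzero X Y)) Deq_compZr.
exact: Deq_scale0.
Qed.

Lemma scaled0 X Y c : Dscale c (dzero X Y) ≈ dzero X Y.
Proof.
rewrite {1}(dzero_scale (dzero X Y)) Deq_scaleA mulr0.
exact: Deq_scale0.
Qed.

Lemma iso_monic X Y Z (u : dhom Y Z) (f g : dhom X Y) :
  is_iso u -> u ∘ f ≈ u ∘ g -> f ≈ g.
Proof.
case=> v [vu _] h; rewrite -(Deq_idl f) -(Deq_idl g) -vu.
by rewrite -!Deq_compA h.
Qed.

Lemma iso_epic X Y Z (u : dhom X Y) (f g : dhom Y Z) :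
  is_iso u -> f ∘ u ≈ g ∘ u -> f ≈ g.
Proof.
case=> v [_ uv] h; rewrite -(Deq_idr f) -(Deq_idr g) -uv.
by rewrite !Deq_compA h.
Qed.

Lemma is_iso_id X : is_iso (did X).
Proof. by exists (did X); rewrite Deq_idl. Qed.

Lemma is_iso_comp X Y Z (u : dhom Y Z) (v : dhom X Y) :
  is_iso u -> is_iso v -> is_iso (u ∘ v).
Proof.
case=> u' [u'u uu'] [v' [v'v vv']]; exists (v' ∘ u'); split.
  by rewrite -Deq_compA (Deq_compA u') u'u Deq_idl.
by rewrite -Deq_compA (Deq_compA v) vv' Deq_idl.
Qed.

Lemma is_iso_sym X Y (u : dhom X Y) :
  is_iso u -> exists2 v : dhom Y X, is_iso v & v ∘ u ≈ did X /\ u ∘ v ≈ did Y.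
Proof. by case=> v [vu uv]; exists v => //; exists u. Qed.

Lemma is_iso_qis X Y (s : cmap X Y) : qis s -> is_iso (Dmap s).
Proof. by move=> qs; exists (Dinv qs); rewrite Deq_invl Deq_invr. Qed.

Lemma quasi_isomorphic_iso X Y :
  quasi_isomorphic X Y -> exists u : dhom X Y, is_iso u.
Proof.
elim=> {X Y} [X Y [s qs]|X|X Y _ [u]|X Y Z _ [u iu] _ [v iv]].
- by exists (Dmap s); apply: is_iso_qis.
- by exists (did X); apply: is_iso_id.
- by move=> /is_iso_sym[v iv _]; exists v.
- by exists (v ∘ u); apply: is_iso_comp.
Qed.

End Derived.

Section FunctorFacts.
Variables (k : fieldType) (A B : superalg k).

Lemma fmap_zero (F : dfunctor A B) X Y : fmap F (dzero X Y) ≈ dzero (F X) (F Y).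
Proof.
rewrite (dzero_scale (dzero X Y)) fmapZ; apply: Deq_scale0.
Qed.

Lemma fmap_iso (F : dfunctor A B) X Y (u : dhom X Y) :
  is_iso u -> is_iso (fmap F u).
Proof.
by case=> v [vu uv]; exists (fmap F v); rewrite -!fmapM vu uv !fmap_id.
Qed.

(** By induction on the generators, naturality on chain maps suffices. For a formal inverse, cancel
    the isomorphism [fmap S (Dmap s)] on the right. *)
Lemma dhom_natural (S T : dfunctor A B) (nu : forall X, dhom (S X) (T X)) :
  (forall X Y (f : cmap X Y),
     nu Y ∘ fmap S (Dmap f) ≈ fmap T (Dmap f) ∘ nu X) ->
  forall X Y (h : dhom X Y), nu Y ∘ fmap S h ≈ fmap T h ∘ nu X.
Proof.
move=> H X Y; elim=> {X Y} [//|X Y s qs|X Y Z g hg f hf|X Y f hf g hg|X Y c f hf].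
- apply: (@iso_epic _ _ _ _ _ (fmap S (Dmap s))).
    exact/fmap_iso/is_iso_qis.
  rewrite -!Deq_compA -fmapM Deq_invl fmap_id Deq_idr H Deq_compA -fmapM.
  by rewrite Deq_invl fmap_id Deq_idl.
- by rewrite !fmapM Deq_compA hg -Deq_compA hf Deq_compA.
- by rewrite !fmapD Deq_compDl Deq_compDr hf hg.
- by rewrite !fmapZ Deq_compZl Deq_compZr hf.
Qed.

End FunctorFacts.

(** The naturality square of [al] recovers f from its image under the composite of F and G. *)
Lemma equivalence_faithful k (A B : superalg k) (F : dfunctor A B)
    (G : dfunctor B A) (al : natiso (dfcomp G F) (dfid A)) X Y (f g : dhom X Y) :
  fmap F f ≈ fmap F g -> f ≈ g.
Proof.
move=> h; apply: (iso_epic (nt_iso al X)).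
have hf := nt_nat al f; have hg := nt_nat al g; move: hf hg => /= <- <-.
by rewrite h.
Qed.

(** The candidate g is G h conjugated by [al]. By naturality G F g and G h agree, and G is faithful
    because of the other isomorphism [be]. *)
Lemma equivalence_full k (A B : superalg k) (F : dfunctor A B)
    (G : dfunctor B A) : quasi_inverse F G ->
  forall X Y (h : dhom (F X) (F Y)), exists g : dhom X Y, fmap F g ≈ h.
Proof.
case=> -[al] [be] X Y h.
have [a' _ [aa' a'a]] := is_iso_sym (nt_iso al X).
exists (nt al Y ∘ fmap G h ∘ a').
apply: (equivalence_faithful be); apply: (iso_monic (nt_iso al Y)).
rewrite [X in X ≈ _](nt_nat al) /=.
by rewrite -!Deq_compA aa' Deq_idr.
Qed.

(** * Cohomology *)

Section Cohomology.
Variables (k : fieldType) (A : superalg k) (m : int).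
Implicit Types X Y Z : cpx A.

(** The degree is written m + 1 so that the incoming differential lands in it without a transport
    along an equation of integers. *)
Definition cocycles X : {vspace X (m + 1)} := lker (cd X (m + 1)).
Definition coboundaries X : {vspace X (m + 1)} := limg (cd X m).

(* The image of this projector is a model of H^(m+1)(X). *)
Definition harmonic X : 'End(X (m + 1)) := addv_pi1 (cocycles X) (coboundaries X).

Lemma coboundary_cocycle X : (coboundaries X <= cocycles X)%VS.
Proof.
apply/subvP => _ /memv_imgP[y _ ->]; rewrite memv_ker; apply/eqP.
exact: cdd.
Qed.

Lemma harmonic_cocycle X x : harmonic X x \in cocycles X.
Proof. exact: memv_pi1. Qed.

Lemma harmonic_split X x :
  x \in cocycles X -> exists2 b, b \in coboundaries X & x = harmonic X x + b.
Proof.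
move=> hx; exists (addv_pi2 (cocycles X) (coboundaries X) x).
  exact: memv_pi2.
by rewrite addv_pi1_pi2 // (addv_idPl (coboundary_cocycle X)).
Qed.

Lemma harmonic_coboundary X x : x \in coboundaries X -> harmonic X x = 0.
Proof.
move=> hx; have := @addv_pi1_pi2 _ _ (cocycles X) (coboundaries X) x.
rewrite (addv_idPl (coboundary_cocycle X)) => /(_ (subvP (coboundary_cocycle X) _ hx)).
by rewrite addv_pi2_id // => h; apply: (addIr x); rewrite add0r.
Qed.

Lemma harmonic_id X x : harmonic X (harmonic X x) = harmonic X x.
Proof. exact: addv_pi1_proj. Qed.

Lemma cmap_cocycle X Y (f : cmap X Y) x :
  x \in cocycles X -> f (m + 1) x \in cocycles Y.
Proof.
by rewrite !memv_ker => /eqP hx; rewrite -cfun_d hx linear0.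
Qed.

Lemma cmap_coboundary X Y (f : cmap X Y) x :
  x \in coboundaries X -> f (m + 1) x \in coboundaries Y.
Proof.
by case/memv_imgP=> y _ ->; rewrite cfun_d memv_img ?memvf.
Qed.

(** A cocycle and its harmonic part differ by a coboundary, which f maps to a coboundary, and
    [harmonic] kills those. *)
Lemma harmonic_cmap X Y (f : cmap X Y) x : x \in cocycles X ->
  harmonic Y (f (m + 1) (harmonic X x)) = harmonic Y (f (m + 1) x).
Proof.
case/harmonic_split=> b hb e; rewrite [in RHS]e !linearD /=.
by rewrite (harmonic_coboundary (cmap_coboundary f hb)) addr0.
Qed.

Definition cmap_coh X Y (f : cmap X Y) : 'Hom(X (m + 1), Y (m + 1)) :=
  (harmonic Y \o (f (m + 1) \o harmonic X))%VF.

Lemma cmap_cohE X Y (f : cmap X Y) x :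
  cmap_coh f x = harmonic Y (f (m + 1) (harmonic X x)).
Proof. by rewrite !comp_lfunE. Qed.

(** Cohomology in degree m + 1, read through the projectors [harmonic]: identities go to [harmonic],
    a formal inverse to a pseudo-inverse cut down by the projectors. Action and grading are
    forgotten, since only the underlying linear maps have to be compared. *)
Fixpoint coh X Y (h : dhom X Y) : 'Hom(X (m + 1), Y (m + 1)) :=
  match h with
  | Dmap _ _ f => cmap_coh f
  | Dinv X Y s _ => (harmonic X \o ((cmap_coh s)^-1 \o harmonic Y))%VF
  | Dcomp _ _ _ g f => (coh g \o coh f)%VF
  | Dadd _ _ f g => coh f + coh g
  | Dscale _ _ c f => c *: coh f
  end.

(** Together with [coh_harmonic]: the projectors act as identities on the values of [coh], as the
    relations [Deq_idl] and [Deq_idr] require. *)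
Lemma harmonic_coh X Y (h : dhom X Y) x : harmonic Y (coh h x) = coh h x.
Proof.
elim: h x => {X Y} /= [X Y f|X Y s qs|X Y Z g hg f hf|X Y f hf g hg|X Y c f hf] x;
  rewrite ?add_lfunE ?scale_lfunE ?comp_lfunE ?linearD ?linearZ /=.
all: by rewrite ?harmonic_id ?hf ?hg.
Qed.

Lemma coh_harmonic X Y (h : dhom X Y) x : coh h (harmonic X x) = coh h x.
Proof.
elim: h x => {X Y} /= [X Y f|X Y s qs|X Y Z g hg f hf|X Y f hf g hg|X Y c f hf] x;
  rewrite ?add_lfunE ?scale_lfunE ?comp_lfunE ?linearD ?linearZ /=.
all: by rewrite ?harmonic_id ?hf ?hg.
Qed.

Lemma cmap_coh_inj X Y (s : cmap X Y) x :
  qis s -> cmap_coh s x = 0 -> harmonic X x = 0.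
Proof.
move=> qs; rewrite cmap_cohE => hx.
have hZ := harmonic_cocycle x; have := cmap_cocycle s hZ.
case/harmonic_split=> b; rewrite hx add0r => /memv_imgP[y _ ->] hy.
have [] := (qs m).1 (harmonic X x).
- by move: hZ; rewrite memv_ker => /eqP.
- by exists y.
move=> x' e; rewrite -harmonic_id e; apply/harmonic_coboundary/memv_img.
exact: memvf.
Qed.

Lemma cmap_coh_surj X Y (s : cmap X Y) y :
  qis s -> exists x, cmap_coh s x = harmonic Y y.
Proof.
move=> qs; have hZ := harmonic_cocycle y.
have [|x hx [y' hy']] := (qs m).2 (harmonic Y y).
  by move: hZ; rewrite memv_ker => /eqP.
exists x; rewrite cmap_cohE harmonic_cmap ?memv_ker ?hx //.
rewrite -[RHS]harmonic_id; apply/esym/eqP; rewrite -subr_eq0 -linearB.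
apply/eqP/harmonic_coboundary; rewrite hy'.
exact/memv_img/memvf.
Qed.

Lemma cmap_cohV X Y (s : cmap X Y) y : qis s ->
  cmap_coh s ((cmap_coh s)^-1%VF (harmonic Y y)) = harmonic Y y.
Proof.
move=> qs; apply: limg_lfunVK; have [x <-] := cmap_coh_surj y qs.
exact/memv_img/memvf.
Qed.

Lemma coh_deq X Y (f g : dhom X Y) : f ≈ g -> coh f = coh g.
Proof.
elim=> {X Y f g} /=.
- by [].
- by [].
- by move=> X Y f g h _ -> _ ->.
- by move=> X Y Z g g' f f' _ -> _ ->.
- by move=> X Y f f' g g' _ -> _ ->.
- by move=> X Y c f f' _ ->.
- by move=> *; rewrite comp_lfunA.
- move=> X Y f; apply/lfunP=> x; rewrite comp_lfunE cmap_cohE id_lfunE.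
  by rewrite harmonic_id harmonic_coh.
- move=> X Y f; apply/lfunP=> x; rewrite comp_lfunE cmap_cohE id_lfunE.
  by rewrite !coh_harmonic.
- by move=> *; apply: addrC.
- by move=> *; apply: addrA.
- move=> X Y f; apply/lfunP=> x.
  by rewrite scale0r cmap_cohE !zero_lfunE linear0.
- by move=> *; rewrite scale1r.
- by move=> *; rewrite scalerA.
- by move=> *; rewrite scalerDl.
- by move=> *; rewrite scalerDr.
- by move=> *; rewrite comp_lfunDl.
- by move=> *; rewrite comp_lfunDr.
- by move=> *; rewrite comp_lfunZl.
- by move=> *; rewrite comp_lfunZr.
- by move=> X Y f g e; apply/lfunP=> x; rewrite !cmap_cohE e.
- move=> X Y Z g f; apply/lfunP=> x; rewrite comp_lfunE !cmap_cohE /=.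
  rewrite comp_lfunE harmonic_id harmonic_cmap //.
  exact/cmap_cocycle/harmonic_cocycle.
- move=> X Y f g; apply/lfunP=> x.
  by rewrite add_lfunE !cmap_cohE /= add_lfunE linearD.
- move=> X Y c f; apply/lfunP=> x.
  by rewrite scale_lfunE !cmap_cohE /= scale_lfunE linearZ.
- move=> X Y s qs; apply/lfunP=> x; rewrite 3!comp_lfunE [in RHS]cmap_cohE id_lfunE.
  (* Both sides have the same image under the map of s on cohomology, which is injective on harmonic
     parts. *)
  apply/eqP; rewrite harmonic_id -subr_eq0 -linearB; apply/eqP.
  apply: (cmap_coh_inj qs); rewrite linearB /= cmap_cohV //.
  by rewrite (harmonic_coh (Dmap s)) subrr.
- move=> X Y s qs; apply/lfunP=> y.
  transitivity (cmap_coh s (harmonic X ((cmap_coh s)^-1%VF (harmonic Y y)))).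
    by rewrite !comp_lfunE.
  rewrite [LHS](coh_harmonic (Dmap s)) cmap_cohV // [in RHS]cmap_cohE id_lfunE.
  by rewrite harmonic_id.
Qed.

End Cohomology.

Definition concentrated k (A : superalg k) (n : int) (X : cpx A) :=
  forall j, j != n -> forall x : X j, x = 0.

(** For complexes concentrated in degree n, every element of degree n is a cocycle and no nonzero
    one is a coboundary. So [harmonic] is the identity there, and [coh] returns the chain map
    itself. *)
Lemma Dmap_faithful k (A : superalg k) n (X Y : cpx A) (f g : cmap X Y) :
  concentrated n X -> concentrated n Y -> Dmap f ≈ Dmap g -> ceq f g.
Proof.
have -> : n = (n - 1) + 1 by rewrite subrK.
move: (n - 1) => {}n hX hY h j x.
have [e|hj] := eqVneq j (n + 1); last by rewrite [LHS]hY // [RHS]hY.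
subst j; have /lfunP/(_ x) := coh_deq n h.
have id_h (Z : cpx A) (z : Z (n + 1)) : concentrated (n + 1) Z -> harmonic n Z z = z.
  move=> hZ; have [|b /memv_imgP[y _ ->]] := @harmonic_split _ _ n Z z.
    by rewrite memv_ker (hZ _ _ (cd _ _ _)) //; lia.
  by rewrite (hZ n _ y) ?linear0 ?addr0 //; lia.
by rewrite /= !cmap_cohE !id_h.
Qed.

(** * Truncation and morphisms between concentrated complexes *)

Section Submodules.
Variables (k : fieldType) (A : superalg k).
Implicit Types M N : gmod A.

(** Graded submodules, as a predicate on subspaces. *)
Definition gstable M (U : {vspace M}) : Prop :=
  (forall a v, v \in U -> gact a v \in U) /\
  (forall v, v \in U -> exists v0 v1,
     [/\ v0 \in U, v1 \in U, v0 \in ggr M false, v1 \in ggr M true & v = v0 + v1]).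

Lemma gstable_full M : gstable (fullv : {vspace M}).
Proof.
split=> [*|v _]; first exact: memvf.
have /is_gradingP[h _] := ggr_dec M; have [v0 [v1 [h0 h1 ->]]] := h v.
by exists v0, v1; rewrite !memvf.
Qed.

Lemma gstable_zero M : gstable (0%VS : {vspace M}).
Proof.
split=> [a v|v]; rewrite !memv0 => /eqP->; first by rewrite gact0.
by exists 0, 0; rewrite !mem0v addr0.
Qed.

(** The images of the two homogeneous components of a kernel element are opposite and of different
    degree, hence both zero. *)
Lemma gstable_ker M N (f : gmap M N) : gstable (lker f).
Proof.
split=> [a v|v]; rewrite memv_ker => /eqP hv.
  by rewrite memv_ker gmap_act hv gact0.
have /is_gradingP[hM _] := ggr_dec M; have /is_gradingP[_ hN] := ggr_dec N.
have [v0 [v1 [h0 h1 e]]] := hM v.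
have fN : f v1 = - f v0.
  by apply/eqP; rewrite -addr_eq0 addrC; move/eqP: hv; rewrite e linearD.
have f0 : f v0 = 0.
  by apply: hN; [|rewrite -[f v0]opprK -fN memvN]; apply: gmap_gr.
by exists v0, v1; rewrite !memv_ker fN f0 oppr0.
Qed.

(** [vsproj] only restores the type: its argument already lies in U by stability. *)
Program Definition gsub M (U : {vspace M}) (hU : gstable U) : gmod A :=
  @Gmod _ _ (subvs_of U) (fun a v => vsproj U (gact a (vsval v)))
    (fun i => linfun (vsval : subvs_of U -> M) @^-1: ggr M i)%VS _ _ _ _ _ _.
Next Obligation.
by move=> M U hU v c a b; rewrite /= (gact_linl (g := M)) linearP.
Qed.
Next Obligation.
by move=> M U hU a c v w; rewrite /= (gact_linr (g := M)) linearP.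
Qed.
Next Obligation. by move=> M U hU v; rewrite /= gact1 vsvalK. Qed.
Next Obligation.
by move=> M U hU a b v; rewrite /= gactM vsprojK // hU.1 ?subvsP.
Qed.
Next Obligation.
move=> M U hU; apply/is_gradingP; split=> v.
  have [v0 [v1 [U0 U1 h0 h1 e]]] := hU.2 _ (subvsP v).
  exists (vsproj U v0), (vsproj U v1).
  rewrite -!memv_preim !lfunE /= !vsprojK //; split=> //.
  by apply: val_inj; rewrite /= !vsprojK.
rewrite -!memv_preim !lfunE /= => h0 h1; apply: val_inj => /=.
by have /is_gradingP[_ h] := ggr_dec M; apply: h.
Qed.
Next Obligation.
move=> M U hU i j a v ha; rewrite -!memv_preim !lfunE /= => hv.
by rewrite vsprojK ?hU.1 ?subvsP // gactG.
Qed.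

Program Definition gsub_incl M (U : {vspace M}) (hU : gstable U) :
  gmap (gsub hU) M := @Gmap _ _ (gsub hU) M (linfun vsval) _ _.
Next Obligation.
by move=> M U hU a v; rewrite !lfunE /= vsprojK // hU.1 ?subvsP.
Qed.
Next Obligation. by move=> M U hU i v; rewrite -memv_preim. Qed.

Lemma gsub_inclE M (U : {vspace M}) (hU : gstable U) v :
  gsub_incl hU v = vsval v.
Proof. by rewrite lfunE. Qed.

(* Junk unless f takes its values in U. *)
Definition gsub_lift_fun M N (U : {vspace N}) (f : 'Hom(M, N)) :
  'Hom(M, subvs_of U) := (linfun (vsproj U) \o f)%VF.

Program Definition gsub_lift M N (U : {vspace N}) (hU : gstable U)
    (f : gmap M N) (fU : forall v, f v \in U) : gmap M (gsub hU) :=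
  @Gmap _ _ M (gsub hU) (gsub_lift_fun U f) _ _.
Next Obligation.
move=> M N U hU f fU a v; rewrite !comp_lfunE !lfunE /=.
by rewrite vsprojK // gmap_act.
Qed.
Next Obligation.
move=> M N U hU f fU i v hv; rewrite -memv_preim comp_lfunE !lfunE /= vsprojK //.
exact: gmap_gr.
Qed.

Lemma gsub_liftE M N (U : {vspace N}) (hU : gstable U)
    (f : gmap M N) (fU : forall v, f v \in U) v :
  vsval (gsub_lift hU fU v) = f v.
Proof. by rewrite comp_lfunE lfunE /= vsprojK. Qed.

End Submodules.

Section Truncation.
Variables (k : fieldType) (A : superalg k) (n : int).
Implicit Types X Y N : cpx A.

(** The canonical truncation in degrees at most n. Taking the kernel in degree n keeps the
    cohomology there, so quasi-isomorphisms are preserved. *)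
Definition trunc_sub X j : {vspace X j} :=
  if j < n then fullv else if j == n then lker (cd X j) else 0%VS.

Lemma trunc_stable X j : gstable (trunc_sub X j).
Proof.
rewrite /trunc_sub; case: ifP => _; first exact: gstable_full.
by case: ifP => _; [apply: gstable_ker|apply: gstable_zero].
Qed.

Lemma trunc_sub_lt X j (x : X j) : j < n -> x \in trunc_sub X j.
Proof. by rewrite /trunc_sub => ->; rewrite memvf. Qed.

Lemma trunc_sub_cycle X j (x : X j) :
  j <= n -> cd X j x = 0 -> x \in trunc_sub X j.
Proof.
rewrite /trunc_sub le_eqVlt; case: (j < n) => [|/=]; first by rewrite memvf.
by rewrite orbF => -> h; rewrite memv_ker h.
Qed.

Lemma trunc_sub_gt X j (x : X j) : n < j -> x \in trunc_sub X j -> x = 0.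
Proof.
rewrite /trunc_sub => h; have /negPf-> : ~~ (j < n) by lia.
have /negPf-> : j != n by lia.
by rewrite memv0 => /eqP.
Qed.

Lemma trunc_sub_eq X (x : X n) : x \in trunc_sub X n -> cd X n x = 0.
Proof. by rewrite /trunc_sub ltxx eqxx memv_ker => /eqP. Qed.

Lemma trunc_sub_d X j (x : X j) :
  x \in trunc_sub X j -> cd X j x \in trunc_sub X (j + 1).
Proof.
have [jn|jn|e] := ltgtP j n.
- by move=> _; apply: trunc_sub_cycle (cdd _); lia.
- by move/trunc_sub_gt=> -> //; rewrite linear0 mem0v.
- by subst j; move/trunc_sub_eq=> ->; rewrite mem0v.
Qed.

Lemma trunc_sub_map X Y (f : cmap X Y) j (x : X j) :
  x \in trunc_sub X j -> f j x \in trunc_sub Y j.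
Proof.
have [jn|jn|e] := ltgtP j n; first by move=> _; apply: trunc_sub_lt.
  by move/trunc_sub_gt=> -> //; rewrite linear0 mem0v.
subst j; move/trunc_sub_eq=> h; apply: trunc_sub_cycle => //.
by rewrite -cfun_d h linear0.
Qed.

Lemma trunc_dP X j (v : gsub (trunc_stable X j)) :
  gcomp (cd X j) (gsub_incl _) v \in trunc_sub X (j + 1).
Proof. by rewrite comp_lfunE gsub_inclE trunc_sub_d ?subvsP. Qed.

Definition trunc_d X j :
    gmap (gsub (trunc_stable X j)) (gsub (trunc_stable X (j + 1))) :=
  gsub_lift _ (@trunc_dP X j).

Lemma trunc_dE X j v : vsval (trunc_d X j v) = cd X j (vsval v).
Proof. by rewrite gsub_liftE comp_lfunE gsub_inclE. Qed.

Program Definition trunc X : cpx A := @Cpx _ _ _ (trunc_d X) _ _.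
Next Obligation.
by move=> X j x; apply: subvs_inj; rewrite !trunc_dE cdd.
Qed.
Next Obligation.
move=> X; have [b hb] := cbounded X; exists b => j hj x.
by apply: subvs_inj; rewrite (hb _ hj (vsval x)).
Qed.

Lemma trunc_mapP X Y (f : cmap X Y) j (v : trunc X j) :
  gcomp (f j) (gsub_incl _) v \in trunc_sub Y j.
Proof. by rewrite comp_lfunE gsub_inclE trunc_sub_map ?subvsP. Qed.

Definition trunc_map_ob X Y (f : cmap X Y) j : gmap (trunc X j) (trunc Y j) :=
  gsub_lift _ (@trunc_mapP X Y f j).

Lemma trunc_map_obE X Y (f : cmap X Y) j v :
  vsval (trunc_map_ob f j v) = f j (vsval v).
Proof. by rewrite gsub_liftE comp_lfunE gsub_inclE. Qed.

Program Definition trunc_map X Y (f : cmap X Y) : cmap (trunc X) (trunc Y) :=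
  @Cmap _ _ (trunc X) (trunc Y) (trunc_map_ob f) _.
Next Obligation.
move=> X Y f j x; apply: subvs_inj.
by rewrite /= !trunc_map_obE !trunc_dE trunc_map_obE cfun_d.
Qed.

Lemma trunc_mapE X Y (f : cmap X Y) j (v : trunc X j) :
  vsval (trunc_map f j v) = f j (vsval v).
Proof. exact: trunc_map_obE. Qed.

Program Definition trunc_incl X : cmap (trunc X) X :=
  @Cmap _ _ (trunc X) X (fun j => gsub_incl (trunc_stable X j)) _.
Next Obligation. by move=> X j x; rewrite !gsub_inclE trunc_dE. Qed.

(** In degree n the map f takes values in cycles, because X vanishes in degree n + 1. *)
Lemma trunc_lift X Y (f : cmap X Y) : concentrated n X ->
  exists g : cmap X (trunc Y), ceq (ccomp (trunc_incl Y) g) f.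
Proof.
move=> hX.
have fP j (x : X j) : f j x \in trunc_sub Y j.
  have [e|hj] := eqVneq j n; last by rewrite (hX _ hj x) linear0 mem0v.
  apply: trunc_sub_cycle; first by rewrite e.
  rewrite -cfun_d (hX _ _ (cd X j x)) ?linear0 //; lia.
have gd j (x : X j) : gsub_lift (trunc_stable Y (j + 1)) (@fP (j + 1)) (cd X j x)
    = trunc_d Y j (gsub_lift (trunc_stable Y j) (@fP j) x).
  by apply: subvs_inj; rewrite trunc_dE !gsub_liftE cfun_d.
exists (@Cmap _ _ X (trunc Y) (fun j => gsub_lift (trunc_stable Y j) (@fP j)) gd).
by move=> j x; rewrite comp_lfunE gsub_inclE gsub_liftE.
Qed.

Lemma trunc_qis X Y (f : cmap X Y) : qis f -> qis (trunc_map f).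
Proof.
move=> qf m; have [hi hs] := qf m.
(* Above degree n both truncations vanish. Otherwise m < n, so elements of degree m are
   unrestricted, and cycles of degree m + 1 lie in the truncation. *)
have [nm|mn] := ltP n (m + 1).
  split=> x; have x0 : x = 0 by apply/subvs_inj/(trunc_sub_gt nm)/subvsP.
    by exists 0; rewrite x0 linear0.
  by exists 0; [rewrite linear0|exists 0; rewrite x0 !linear0 addr0].
split=> [x hx [y hy]|y hy].
- have [||x' hx'] := hi (vsval x).
  + by rewrite -trunc_dE hx.
  + by exists (vsval y); rewrite -trunc_mapE hy trunc_dE.
  have x'P : x' \in trunc_sub X m by apply: trunc_sub_lt; lia.
  by exists (vsproj _ x'); apply: subvs_inj; rewrite trunc_dE vsprojK.
- have [|x hx [y' hy']] := hs (vsval y).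
    by rewrite -trunc_dE hy.
  have y'P : y' \in trunc_sub Y m by apply: trunc_sub_lt; lia.
  have xP := trunc_sub_cycle mn hx.
  exists (vsproj _ x); first by apply: subvs_inj; rewrite trunc_dE vsprojK.
  exists (vsproj _ y'); apply: subvs_inj; rewrite trunc_dE vsprojK //.
  by rewrite linearB /= trunc_mapE vsprojK.
Qed.

Definition truncation : dfunctor A A.
Proof.
apply: (@induced k A A trunc trunc_map trunc_qis).
- by move=> X Y f g e j x; apply: subvs_inj; rewrite !trunc_mapE e.
- by move=> X j x; apply: subvs_inj; rewrite trunc_mapE /= !id_lfunE.
- move=> X Y Z g f j x; apply: subvs_inj.
  by rewrite trunc_mapE /= [in LHS]comp_lfunE [in RHS]comp_lfunE !trunc_mapE.
- by move=> X Y j x; apply: subvs_inj; rewrite trunc_mapE /= !zero_lfunE linear0.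
- move=> X Y f g j x; apply: subvs_inj.
  by rewrite trunc_mapE /= !add_lfunE linearD /= !trunc_mapE.
- move=> X Y c f j x; apply: subvs_inj.
  by rewrite trunc_mapE /= !scale_lfunE linearZ /= !trunc_mapE.
Defined.

End Truncation.

Lemma concentrated_cmap k (A : superalg k) n (X N : cpx A)
    (g : gmap (X (n + 1)) (N (n + 1))) :
  concentrated (n + 1) N -> (forall y, g (cd X n y) = 0) ->
  exists q : cmap X N, forall x, q (n + 1) x = g x.
Proof.
move=> hN hg.
(* The map g is transported to degree j when j = n + 1. At n + 1 itself the transport is trivial by
   uniqueness of identity proofs on [int]. *)
pose q j : gmap (X j) (N j) :=
  match eqVneq j (n + 1) with
  | EqNotNeq e => eq_rect_r (fun j => gmap (X j) (N j)) g e
  | _ => gzero _ _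
  end.
have qn : q (n + 1) = g.
  by rewrite /q; case: eqVneq => [e|/eqP//]; rewrite (eq_axiomK e).
have qd j (x : X j) : q (j + 1) (cd X j x) = cd N j (q j x).
  have [e|hj] := eqVneq j n; last by rewrite [LHS]hN ?[RHS]hN //; lia.
  by subst j; rewrite qn hg (hN n _ (q n x)) ?linear0 //; lia.
by exists (Cmap qd) => x; rewrite /= qn.
Qed.

(** The universal property of a quotient: compose g with a linear section of p. The hypothesis on
    the kernel makes the result independent of the section, hence a graded module map. *)
Lemma gmap_factor k (A : superalg k) (M N Q : gmod A) (p : gmap M N) (g : gmap M Q) :
  (forall y, exists x, p x = y) -> (forall x, p x = 0 -> g x = 0) ->
  exists g' : gmap N Q, forall x, g' (p x) = g x.
Proof.
move=> p_surj pg0; pose g' : 'Hom(N, Q) := (gfun g \o (gfun p)^-1)%VF.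
have g'p x : g' (p x) = g x.
  apply/eqP; rewrite comp_lfunE -subr_eq0 -linearB /=; apply/eqP/pg0.
  by rewrite linearB /= limg_lfunVK ?subrr // memv_img ?memvf.
have g'_act a y : g' (gact a y) = gact a (g' y).
  by have [x <-] := p_surj y; rewrite -gmap_act !g'p gmap_act.
have g'_gr i y : y \in ggr N i -> g' y \in ggr Q i.
  have [x <-] := p_surj y; have /is_gradingP[hM _] := ggr_dec M.
  have /is_gradingP[_ hN] := ggr_dec N; have [x0 [x1 [h0 h1 e]]] := hM x.
  have p0 := gmap_gr p h0; have p1 := gmap_gr p h1.
  (* If p x is homogeneous of degree i, the component of x of the other degree lies in the kernel of
     p, so g kills it too. *)
  rewrite g'p e !linearD /=; case: i => h.
    have p00 : p x0 = 0 by apply: hN => //; rewrite -[p x0](addrK (p x1)) memvB.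
    by rewrite (pg0 _ p00) add0r gmap_gr.
  have p10 : p x1 = 0.
    by apply: hN => //; rewrite -[p x1](addKr (p x0)) memvD // memvN.
  by rewrite (pg0 _ p10) addr0 gmap_gr.
by exists (Gmap g'_act g'_gr).
Qed.

(** A map from the truncation to N is a map on H^n. Concretely, the degree n term of the truncation
    of Y is covered by that of X together with boundaries from degree n - 1. If (x, y) maps to zero,
    then x is a boundary because s is injective on cohomology, and q kills boundaries because N
    vanishes in degree n - 1. *)
Lemma trunc_qis_factor k (A : superalg k) n (X Y N : cpx A) (s : cmap X Y)
    (q : cmap (trunc n X) N) :
  qis s -> concentrated n N ->
  exists q' : cmap (trunc n Y) N, ceq (ccomp q' (trunc_map n s)) q.
Proof.
have [m e] : exists m : int, n = m + 1 by exists (n - 1); rewrite subrK.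
subst n; move: m q => n q qs hN; set ts := trunc_map _ s.
have [hi hs] := @trunc_qis _ _ (n + 1) _ _ s qs n.
pose S := gsum (trunc (n + 1) X (n + 1)) (trunc (n + 1) Y n).
pose p : gmap S (trunc (n + 1) Y (n + 1)) :=
  gadd (gcomp (ts (n + 1)) (gfst _ _)) (gcomp (cd (trunc (n + 1) Y) n) (gsnd _ _)).
pose g : gmap S (N (n + 1)) := gcomp (q (n + 1)) (gfst _ _).
have pE x : p x = ts (n + 1) x.1 + cd (trunc (n + 1) Y) n x.2.
  by rewrite add_lfunE !comp_lfunE lfstE lsndE.
have gE x : g x = q (n + 1) x.1 by rewrite comp_lfunE lfstE.
have cyc Z (z : trunc (n + 1) Z (n + 1)) : cd (trunc (n + 1) Z) (n + 1) z = 0.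
  apply: subvs_inj; apply: (@trunc_sub_gt _ _ (n + 1)); last exact: subvsP.
  lia.
have [||q' hq'] := @gmap_factor _ _ _ _ _ p g.
- move=> y; have [|x hx [y' hy']] := hs y; first exact: cyc.
  by exists (x, y'); rewrite pE -hy' addrCA subrr addr0.
- move=> [x y]; rewrite pE gE /= => /eqP; rewrite addr_eq0 => /eqP e.
  have [||x' ->] := hi x; first exact: cyc.
    by exists (- y); rewrite linearN.
  by rewrite [LHS](cfun_d q x') (hN n _ (q n x')) ?linear0 //; lia.
have [|q'' hq''] := @concentrated_cmap _ _ _ (trunc (n + 1) Y) N q' hN.
  by move=> y; have := hq' (0, y); rewrite pE gE /= !linear0 add0r.
exists q'' => j x.
have [e|hj] := eqVneq j (n + 1); last by rewrite [LHS]hN ?[RHS]hN.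
subst j; rewrite comp_lfunE hq''.
by have := hq' (x, 0); rewrite pE gE /= linear0 addr0.
Qed.

Section Fullness.
Variables (k : fieldType) (A : superalg k) (n : int).
Implicit Types X Y N : cpx A.

Lemma trunc_incl_nat X Y (h : dhom X Y) :
  Dmap (trunc_incl n Y) ∘ fmap (truncation A n) h ≈ h ∘ Dmap (trunc_incl n X).
Proof.
apply: (@dhom_natural _ _ _ (truncation A n) (dfid A) (fun X => Dmap (trunc_incl n X))).
move=> {h}X' Y' f /=; rewrite -!Deq_mapM; apply: Deq_map => j x.
by rewrite [LHS]comp_lfunE [RHS]comp_lfunE !gsub_inclE trunc_mapE.
Qed.

(* Composites in dhom pass through arbitrary complexes, so an induction on h needs
   a statement without a concentration hypothesis on X and Y; truncating provides
   it, because tau Y still has maps to complexes concentrated in degree n. *)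
Lemma trunc_full X Y (h : dhom X Y) N (q : cmap (trunc n Y) N) :
  concentrated n N ->
  exists q' : cmap (trunc n X) N, Dmap q ∘ fmap (truncation A n) h ≈ Dmap q'.
Proof.
move=> hN; elim: h q => {X Y}
  [X Y f|X Y s qs|X Y Z g hg f hf|X Y f hf g hg|X Y c f hf] q.
- by exists (ccomp q (trunc_map n f)); rewrite Deq_mapM.
- have [q' e] := trunc_qis_factor q qs hN; exists q'.
  by rewrite -(Deq_map e) Deq_mapM -Deq_compA Deq_invr Deq_idr.
- have [q1 e1] := hg q; have [q2 e2] := hf q1; exists q2.
  by rewrite fmapM Deq_compA e1.
- have [q1 e1] := hf q; have [q2 e2] := hg q; exists (cadd q1 q2).
  by rewrite fmapD Deq_compDr e1 e2 Deq_mapD.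
- have [q1 e1] := hf q; exists (cscale c q1).
  by rewrite fmapZ Deq_compZr e1 Deq_mapZ.
Qed.

(** Lift the identity of X to r from X to its truncation. By naturality of the inclusion, h is the
    composite of r, the truncation of h and the inclusion for Y; [trunc_full] makes the last two a
    chain map. *)
Lemma Dmap_full X Y (h : dhom X Y) :
  concentrated n X -> concentrated n Y -> exists f, h ≈ Dmap f.
Proof.
move=> hX hY; have [q e] := trunc_full h (trunc_incl n Y) hY.
have [r hr] := trunc_lift (cid X) hX.
exists (ccomp q r); rewrite Deq_mapM -e trunc_incl_nat -Deq_compA -Deq_mapM.
by rewrite (Deq_map hr) Deq_idr.
Qed.

End Fullness.

(** * A module placed in an arbitrary degree *)

Section Stalk.
Variables (k : fieldType) (A : superalg k) (n : int) (M : gmod A).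

(** For a variable n, a case distinction between M and the zero module does not reduce at j = n.
    Using subspaces of M in every degree avoids transports. *)
Definition stalk_sub (j : int) : {vspace M} := if j == n then fullv else 0%VS.

Lemma stalk_stable j : gstable (stalk_sub j).
Proof.
by rewrite /stalk_sub; case: ifP => _; [apply: gstable_full|apply: gstable_zero].
Qed.

Lemma stalk_sub_ne j (v : M) : j != n -> v \in stalk_sub j -> v = 0.
Proof. by rewrite /stalk_sub => /negPf->; rewrite memv0 => /eqP. Qed.

Program Definition stalk : cpx A :=
  @Cpx _ _ (fun j => gsub (stalk_stable j)) (fun j => gzero _ _) _ _.
Next Obligation. by move=> j x; rewrite zero_lfunE. Qed.
Next Obligation.
exists `|n| => j hj x.
by apply/subvs_inj/(@stalk_sub_ne j); [lia|apply: subvsP].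
Qed.

Lemma stalk_concentrated : concentrated n stalk.
Proof.
by move=> j hj x; apply/subvs_inj/(stalk_sub_ne hj)/subvsP.
Qed.

Lemma mem_stalk_sub v : v \in stalk_sub n.
Proof. by rewrite /stalk_sub eqxx memvf. Qed.

End Stalk.

(** * Parity powers and twisted multiplications *)

Section Gradings.
Variables (k : fieldType) (V : vectType k) (gr : bool -> {vspace V}).
Hypothesis gr_dec : is_grading gr.

Definition gproj (i : bool) : 'End(V) := daddv_pi (gr i) (gr (~~ i)).

Lemma gr_cap i : (gr i :&: gr (~~ i) = 0)%VS.
Proof. by case: i; [rewrite capvC|]; case: gr_dec. Qed.

Lemma gr_add i : (gr i + gr (~~ i) = fullv)%VS.
Proof. by case: i; [rewrite addvC|]; case: gr_dec. Qed.

Lemma mem_gproj i v : gproj i v \in gr i.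
Proof. exact: memv_pi. Qed.

Lemma gproj_id i v : v \in gr i -> gproj i v = v.
Proof. exact/daddv_pi_id/gr_cap. Qed.

Lemma gproj_sum v : gproj false v + gproj true v = v.
Proof. by apply: (daddv_pi_add (gr_cap false)); rewrite gr_add memvf. Qed.

Lemma gproj_other i v : v \in gr i -> gproj (~~ i) v = 0.
Proof.
move=> hv; have := gproj_sum v; case: i hv => hv; rewrite (gproj_id hv) => e.
  by apply: (addIr v); rewrite add0r.
by apply: (addrI v); rewrite addr0.
Qed.

Lemma gr_ind (P : V -> Prop) :
  (forall i v, v \in gr i -> P v) -> (forall u v, P u -> P v -> P (u + v)) ->
  forall v, P v.
Proof.
by move=> h hD v; rewrite -(gproj_sum v); apply: hD; apply: h (mem_gproj _ _).
Qed.

(** The parity involution when b is [true], the identity otherwise. *)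
Definition gsign (b : bool) : 'End(V) := gproj false + (-1) ^+ b *: gproj true.

Lemma gsignE b j v : v \in gr j -> gsign b v = (-1) ^+ (b && j) *: v.
Proof.
move=> hv; rewrite add_lfunE scale_lfunE.
case: j hv => hv; rewrite (gproj_id hv) ?andbT ?andbF.
  by rewrite (gproj_other hv) add0r.
by rewrite (gproj_other hv) scaler0 addr0 scale1r.
Qed.

End Gradings.

Section ParityPowers.
Variables (k : fieldType) (A : superalg k).
Implicit Types X Y Z : cpx A.

Definition parity_pow (i : bool) : dfunctor A A := if i then parity A else dfid A.

(** The parity shift leaves underlying spaces unchanged, but for a variable i the types are not
    convertible; this identity map compares them. *)
Definition parity_val i X n : 'Hom(parity_pow i X n, X n) :=
  match i return 'Hom(parity_pow i X n, X n) with
  | true => (\1%VF : 'End(X n))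
  | false => (\1%VF : 'End(X n))
  end.

Lemma parity_val_inj i X n : injective (parity_val i X n).
Proof. by case: i => u v; rewrite !id_lfunE. Qed.

Lemma parity_val_surj i X n v : exists u, parity_val i X n u = v.
Proof. by case: i; exists v; rewrite id_lfunE. Qed.

Lemma parity_val_act i X n a v :
  parity_val i X n (gact a v) = gact a (parity_val i X n v).
Proof. by case: i v => v; rewrite !id_lfunE. Qed.

Lemma parity_val_gr i X n j v :
  (v \in ggr (parity_pow i X n) j) = (parity_val i X n v \in ggr (X n) (i (+) j)).
Proof. by case: i v => v; rewrite id_lfunE. Qed.

Lemma parity_val_d i X n v :
  parity_val i X (n + 1) (cd (parity_pow i X) n v) = cd X n (parity_val i X n v).
Proof. by case: i v => v; rewrite !id_lfunE. Qed.

Definition parity_pow_map i X Y (f : cmap X Y) :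
    cmap (parity_pow i X) (parity_pow i Y) :=
  match i return cmap (parity_pow i X) (parity_pow i Y) with
  | true => cparity_map f
  | false => f
  end.

Lemma parity_pow_mapE i X Y (f : cmap X Y) n v :
  parity_val i Y n (parity_pow_map i f n v) = f n (parity_val i X n v).
Proof. by case: i v => v; rewrite !id_lfunE. Qed.

Lemma parity_pow_Dmap i X Y (f : cmap X Y) :
  fmap (parity_pow i) (Dmap f) = Dmap (parity_pow_map i f).
Proof. by case: i. Qed.

Lemma parity_pow_concentrated i n X :
  concentrated n X -> concentrated n (parity_pow i X).
Proof. by move=> hX j hj x; apply: (@parity_val_inj i); rewrite [LHS]hX // [RHS]hX. Qed.

Section Make.
Variables (i : bool) (X Y : cpx A) (L : forall n, 'Hom(X n, Y n)).
Hypothesis L_act : forall n a v, L n (gact a v) = gact a (L n v).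
Hypothesis L_gr : forall n j v, v \in ggr (X n) j -> L n v \in ggr (Y n) (i (+) j).
Hypothesis L_d : forall n v, L (n + 1) (cd X n v) = cd Y n (L n v).

(** Linear maps of degree i become chain maps to the i-th parity shift. The sigma type confines the
    case analysis on i to this construction; later proofs use only the values under [parity_val]. *)
Lemma parity_cmap_spec :
  {g : cmap X (parity_pow i Y) | forall n v, parity_val i Y n (g n v) = L n v}.
Proof.
case: i L_gr => gr.
  pose g n : gmap (X n) (gparity (Y n)) :=
    @Gmap _ _ (X n) (gparity (Y n)) (L n) (@L_act n) (@gr n).
  exists (@Cmap _ _ X (cparity Y) g L_d) => n v; exact: id_lfunE.
pose g n : gmap (X n) (Y n) := @Gmap _ _ (X n) (Y n) (L n) (@L_act n) (@gr n).
exists (@Cmap _ _ X Y g L_d) => n v; exact: id_lfunE.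
Qed.

End Make.

Section Mu.
Variables (i j l : bool) (ijl : i (+) j = l) (X : cpx A).

Let parity_mu_fun n : 'Hom(parity_pow j (parity_pow i X) n, X n) :=
  (parity_val i X n \o parity_val j (parity_pow i X) n)%VF.

(** The identification of two successive shifts with one. The separate index l lets the sums i + j
    and j + i share a target without transport. *)
Lemma parity_mu_spec : {g : cmap (parity_pow j (parity_pow i X)) (parity_pow l X) |
  forall n v, parity_val l X n (g n v) = parity_mu_fun n v}.
Proof.
apply: parity_cmap_spec => n.
- by move=> a v; rewrite !comp_lfunE !parity_val_act.
- by move=> m v; rewrite !parity_val_gr comp_lfunE addbA ijl.
- by move=> v; rewrite !comp_lfunE !parity_val_d.
Qed.

Definition parity_mu : cmap (parity_pow j (parity_pow i X)) (parity_pow l X) :=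
  sval parity_mu_spec.

Lemma parity_muE n v : parity_val l X n (parity_mu n v) =
  parity_val i X n (parity_val j (parity_pow i X) n v).
Proof. by rewrite /parity_mu (svalP parity_mu_spec) comp_lfunE. Qed.

End Mu.

Lemma parity_mu_natural i j l (ijl : i (+) j = l) X Y (h : dhom X Y) :
  Dmap (parity_mu ijl Y) ∘ fmap (parity_pow j) (fmap (parity_pow i) h)
    ≈ fmap (parity_pow l) h ∘ Dmap (parity_mu ijl X).
Proof.
apply: (@dhom_natural _ _ _ (dfcomp (parity_pow j) (parity_pow i)) (parity_pow l)
  (fun X => Dmap (parity_mu ijl X))).
move=> {h}X' Y' f; rewrite [fmap (dfcomp _ _) _]/= !parity_pow_Dmap -!Deq_mapM.
apply: Deq_map => n v; apply: (@parity_val_inj l).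
by rewrite !comp_lfunE parity_pow_mapE !parity_muE !parity_pow_mapE.
Qed.

(** Composition of morphisms of degree i and j, where a morphism of degree i from Y to Z is a map
    from Y to the i-th parity shift of Z. *)
Definition parity_comp i j l (ijl : i (+) j = l) X Y Z
    (g : dhom Y (parity_pow i Z)) (f : dhom X (parity_pow j Y)) :
    dhom X (parity_pow l Z) :=
  Dmap (parity_mu ijl Z) ∘ fmap (parity_pow j) g ∘ f.

Lemma parity_comp0 i j l (ijl : i (+) j = l) X Y Z (g : dhom Y (parity_pow i Z)) :
  parity_comp ijl g (dzero X (parity_pow j Y)) ≈ dzero X (parity_pow l Z).
Proof. exact: compd0. Qed.

Lemma parity_comp_Dmap i j l (ijl : i (+) j = l) X Y Z
    (g : cmap Y (parity_pow i Z)) (f : cmap X (parity_pow j Y)) :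
  exists h : cmap X (parity_pow l Z), parity_comp ijl (Dmap g) (Dmap f) ≈ Dmap h /\
    forall n v, parity_val l Z n (h n v) =
      parity_val i Z n (g n (parity_val j Y n (f n v))).
Proof.
exists (ccomp (ccomp (parity_mu ijl Z) (parity_pow_map j g)) f); split.
  by rewrite !Deq_mapM /parity_comp parity_pow_Dmap.
by move=> n v; rewrite !comp_lfunE parity_muE parity_pow_mapE.
Qed.

End ParityPowers.

#[local] Instance parity_comp_proper k (A : superalg k) i j l ijl X Y Z :
  Proper (@deq k A Y (parity_pow A i Z) ==> @deq k A X (parity_pow A j Y) ==>
          @deq k A X (parity_pow A l Z)) (@parity_comp k A i j l ijl X Y Z).
Proof. by move=> g g' hg f f' hf; rewrite /parity_comp hg hf. Qed.

Lemma sign_andD k (V : lmodType k) (b i j : bool) (v : V) :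
  (-1) ^+ (b && (i (+) j)) *: v = (-1) ^+ (b && i) *: ((-1) ^+ (b && j) *: v) :> V.
Proof. by rewrite scalerA -signr_addb; case: b. Qed.

Lemma signK k (V : lmodType k) (b : bool) (v : V) :
  (-1) ^+ b *: ((-1) ^+ b *: v) = v.
Proof. by rewrite scalerA -signr_addb addbb scale1r. Qed.

Section Eta.
Variables (k : fieldType) (A : superalg k).
Implicit Types X Y Z : cpx A.

Lemma gact_Zl (M : gmod A) c a (v : M) : gact (c *: a) v = c *: gact a v.
Proof.
have h0 : gact (0 : A) v = 0.
  by have := gact_linl v (-1) 0 0; rewrite scaler0 addr0 scaleN1r addNr.
by have := gact_linl v c a 0; rewrite h0 !addr0.
Qed.

Lemma gact_Dl (M : gmod A) a b (v : M) : gact (a + b) v = gact a v + gact b v.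
Proof. by have := gact_linl v 1 a b; rewrite !scale1r. Qed.

Lemma smulDl (x x' y : A) : (x + x') *s y = x *s y + x' *s y.
Proof. exact: (@gact_Dl (gregular A)). Qed.

Lemma smulDr (x y y' : A) : x *s (y + y') = x *s y + x *s y'.
Proof. exact: (@gactD _ _ (gregular A)). Qed.

Lemma smulZl c (x y : A) : (c *: x) *s y = c *: (x *s y).
Proof. exact: (@gact_Zl (gregular A)). Qed.

Lemma smulZr c (x y : A) : x *s (c *: y) = c *: (x *s y).
Proof. exact: (@gactZ _ _ (gregular A)). Qed.

(** The degree i is a parameter because it fixes both the sign and the target of the map attached to
    x. *)
Definition super_central (e i : bool) (x : A) : Prop :=
  x \in sgr A i /\
  forall j y, y \in sgr A j -> x *s y = (-1) ^+ ((i (+) e) && j) *: (y *s x).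

Definition gact_by (M : gmod A) (x : A) (v : M) : M := gact x v.

HB.instance Definition _ (M : gmod A) (x : A) :=
  GRing.isLinear.Build k M M _ (@gact_by M x) (@gact_linr _ _ M x).

Section Construction.
Variables (e i : bool) (x : A) (hx : super_central e i x).

Let L X n : 'End(X n) := (linfun (@gact_by (X n) x) \o gsign (ggr (X n)) (i (+) e))%VF.

Let LE X n j v : v \in ggr (X n) j ->
  L X n v = (-1) ^+ ((i (+) e) && j) *: gact x v.
Proof.
move=> hv; rewrite comp_lfunE lfunE /= (gsignE (ggr_dec _) _ hv).
exact: gactZ.
Qed.

Lemma twist_mul_spec X : {g : cmap X (parity_pow A i X) |
  forall n v, parity_val i X n (g n v) = L X n v}.
Proof.
apply: parity_cmap_spec => n.
- move=> a v; move: a; apply: (gr_ind (sgr_dec A)) => [l a ha|a b ha hb]; last first.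
    by rewrite !gact_Dl linearD /= ha hb.
  move: v; apply: (gr_ind (ggr_dec (X n))) => [j v hv|u v hu hv]; last first.
    by rewrite gactD !linearD /= gactD hu hv.
  (* Moving x past a costs (-1)^((i+e)|a|), which cancels the change of sign from |v| to |a|+|v|. *)
  rewrite (LE hv) (LE (gactG ha hv)) gactZ -!gactM (hx.2 _ _ ha) gact_Zl.
  by rewrite sign_andD scalerA mulrC -scalerA signK.
- move=> j v hv; rewrite (LE hv) memvZ // gactG //; exact: hx.1.
- move=> v; move: v; apply: (gr_ind (ggr_dec (X n))) => [j v hv|u v hu hv]; last first.
    by rewrite !linearD /= hu hv.
  rewrite (LE hv) (LE (gmap_gr (cd X n) hv)) linearZ /=.
  by rewrite gmap_act.
Qed.

(* v |-> (-1)^((i + e)|v|) x v; the sign makes the map A-linear, since x lies in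
   the degree i part of the super (e = false) or anti (e = true) centre. *)
Definition twist_mul X : cmap X (parity_pow A i X) := sval (twist_mul_spec X).

Lemma twist_mulE X n j v : v \in ggr (X n) j ->
  parity_val i X n (twist_mul X n v) = (-1) ^+ ((i (+) e) && j) *: gact x v.
Proof. by rewrite /twist_mul (svalP (twist_mul_spec X)); apply: LE. Qed.

Lemma twist_mul_natural X Y (h : dhom X Y) :
  Dmap (twist_mul Y) ∘ h ≈ fmap (parity_pow A i) h ∘ Dmap (twist_mul X).
Proof.
apply: (@dhom_natural _ _ _ (dfid A) (parity_pow A i) (fun X => Dmap (twist_mul X))).
move=> {h}X' Y' f /=; rewrite !parity_pow_Dmap -!Deq_mapM.
apply: Deq_map => n v; apply: (@parity_val_inj _ _ i).
rewrite !comp_lfunE parity_pow_mapE; move: v.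
apply: (gr_ind (ggr_dec (X' n))) => [j v hv|u v hu hv]; last first.
  by rewrite !linearD /= hu hv.
by rewrite (twist_mulE hv) (twist_mulE (gmap_gr _ hv)) linearZ /= gmap_act.
Qed.

(** Naturality with respect to maps of degree j. The sign arises because the j-th parity shift
    changes all degrees by j, so twisting on the shift of Y differs from the shift of the twist on Y
    by (-1)^((i+e)j). *)
Lemma parity_comp_twist_mul j l (ji : j (+) i = l) (ij : i (+) j = l) X Y
    (t : dhom X (parity_pow A j Y)) :
  parity_comp ji t (Dmap (twist_mul X))
    ≈ Dscale ((-1) ^+ ((i (+) e) && j)) (parity_comp ij (Dmap (twist_mul Y)) t).
Proof.
rewrite /parity_comp -Deq_compA -twist_mul_natural Deq_compA -Deq_compZl.
apply: Deq_comp => //; rewrite parity_pow_Dmap -!Deq_mapM -Deq_mapZ.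
apply: Deq_map => n v; apply: (@parity_val_inj _ _ l).
rewrite scale_lfunE linearZ /= !comp_lfunE !parity_muE parity_pow_mapE; move: v.
apply: (gr_ind (ggr_dec (parity_pow A j Y n))) => [m v hv|u v hu hv]; last first.
  by rewrite !linearD /= hu hv.
move: (hv); rewrite parity_val_gr => hv'.
by rewrite (twist_mulE hv) (twist_mulE hv') linearZ /= parity_val_act sign_andD signK.
Qed.

End Construction.

End Eta.

(** * Transport along the equivalence *)

Section Transport.
Variables (k : fieldType) (A B : superalg k) (F : dfunctor A B).
Variable (S : pi_structure F).

Definition xi i X : dhom (parity_pow B i (F X)) (F (parity_pow A i X)) :=
  match i with
  | true => pi_xi S X
  | false => did (F X)
  end.

Lemma xi_iso i X : is_iso (xi i X).
Proof. case: i; [exact: (nt_iso (pi_xi S) X)|exact: is_iso_id]. Qed.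

Lemma xi_natural i X Y (f : dhom X Y) :
  xi i Y ∘ fmap (parity_pow B i) (fmap F f) 
    ≈ fmap F (fmap (parity_pow A i) f) ∘ xi i X.
Proof. by case: i; [exact: (nt_nat (pi_xi S))|rewrite /= Deq_idl Deq_idr]. Qed.

Lemma parity_mu_eq (C : superalg k) i j l (ijl : i (+) j = l) (X : cpx C)
    (f : cmap (parity_pow C j (parity_pow C i X)) (parity_pow C l X)) :
  (forall n v, parity_val l X n (f n v) =
     parity_val i X n (parity_val j (parity_pow C i X) n v)) ->
  Dmap (parity_mu ijl X) ≈ Dmap f.
Proof.
move=> h; apply: Deq_map => n v; apply: (@parity_val_inj _ _ l).
by rewrite parity_muE h.
Qed.

(** For i and j both odd this is the involution axiom of the parity structure; in the other three
    cases one of the structure maps is an identity. *)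
Lemma xi_mu i j l (ijl : i (+) j = l) X :
  fmap F (Dmap (parity_mu ijl X)) ∘ xi j (parity_pow A i X)
      ∘ fmap (parity_pow B j) (xi i X)
    ≈ xi l X ∘ Dmap (parity_mu ijl (F X)).
Proof.
case: l / ijl; case: i; case: j => /=.
- rewrite (@parity_mu_eq A true true false erefl X (cparity_invol X)); last first.
    by move=> n v; rewrite !id_lfunE.
  rewrite (@parity_mu_eq B true true false erefl (F X) (cparity_invol (F X))); last first.
    by move=> n v; rewrite !id_lfunE.
  by rewrite Deq_idl -Deq_compA; apply: (pi_xi_invol S X).
- rewrite (@parity_mu_eq A true false true erefl X (cid _)); last first.
    by move=> n v; rewrite !id_lfunE.
  rewrite (@parity_mu_eq B true false true erefl (F X) (cid _)); last first.
    by move=> n v; rewrite !id_lfunE.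
  by rewrite (fmap_id F) !Deq_idl Deq_idr.
- rewrite (@parity_mu_eq A false true true erefl X (cid _)); last first.
    by move=> n v; rewrite !id_lfunE.
  rewrite (@parity_mu_eq B false true true erefl (F X) (cid _)); last first.
    by move=> n v; rewrite !id_lfunE.
  rewrite (fmap_id F) !Deq_idl Deq_idr.
  have e : Dmap (cparity_map (cid (F X))) ≈ did _ := fmap_id (parity B) (F X).
  by rewrite e Deq_idr.
- rewrite (@parity_mu_eq A false false false erefl X (cid _)); last first.
    by move=> n v; rewrite !id_lfunE.
  rewrite (@parity_mu_eq B false false false erefl (F X) (cid _)); last first.
    by move=> n v; rewrite !id_lfunE.
  by rewrite (fmap_id F) !Deq_idl.
Qed.

(* h = (Pi^i w)^-1 xi^-1 F(g) u, stated without inverses of w and xi. *)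
Definition transported i X Y X' Y' (u : dhom X' (F X)) (w : dhom Y' (F Y))
    (g : dhom X (parity_pow A i Y)) (h : dhom X' (parity_pow B i Y')) : Prop :=
  fmap F g ∘ u ≈ xi i Y ∘ (fmap (parity_pow B i) w ∘ h).

Section Properties.
Variables (i : bool) (X Y : cpx A) (X' Y' : cpx B).
Variables (u : dhom X' (F X)) (w : dhom Y' (F Y)).

Lemma transported_deq g g' h h' : g ≈ g' -> h ≈ h' ->
  transported (i := i) u w g h -> transported u w g' h'.
Proof. by rewrite /transported => <- <-. Qed.

Lemma transportedD g g' h h' :
  transported (i := i) u w g h -> transported u w g' h' ->
  transported u w (Dadd g g') (Dadd h h').
Proof.
by rewrite /transported fmapD Deq_compDl => -> ->; rewrite !Deq_compDr.
Qed.

Lemma transportedZ c g h :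
  transported (i := i) u w g h -> transported u w (Dscale c g) (Dscale c h).
Proof.
by rewrite /transported fmapZ Deq_compZl => ->; rewrite !Deq_compZr.
Qed.

(** This lemma and the next three show that, for isomorphisms u and w, [transported] is the graph of
    a bijection modulo [deq]; the last two use that F is full and faithful. *)
Lemma transported_exists (iw : is_iso w) g :
  exists h, transported (i := i) u w g h.
Proof.
have [v _ [_ vK]] :=
  is_iso_sym (is_iso_comp (xi_iso i Y) (fmap_iso (parity_pow B i) iw)).
exists (v ∘ (fmap F g ∘ u)); rewrite /transported.
by rewrite !Deq_compA vK Deq_idl.
Qed.

Lemma transported_unique (iw : is_iso w) g h h' :
  transported (i := i) u w g h -> transported u w g h' -> h ≈ h'.
Proof.
move=> e e'; apply: (iso_monic (fmap_iso (parity_pow B i) iw)).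
by apply: (iso_monic (xi_iso i Y)); rewrite -e -e'.
Qed.

Lemma transported_full (G : dfunctor B A) (FG : quasi_inverse F G)
    (iu : is_iso u) h : exists g, transported (i := i) u w g h.
Proof.
have [v' _ [v'K _]] := is_iso_sym iu.
have [g e] := equivalence_full FG (xi i Y ∘ (fmap (parity_pow B i) w ∘ h) ∘ v').
by exists g; rewrite /transported e -Deq_compA v'K Deq_idr.
Qed.

Lemma transported_faithful (G : dfunctor B A) (FG : quasi_inverse F G)
    (iu : is_iso u) g : transported (i := i) u w g (dzero _ _) -> g ≈ dzero _ _.
Proof.
rewrite /transported !compd0 => e; have [[al] _] := FG.
apply: (equivalence_faithful al); apply: (iso_epic iu).
by rewrite e fmap_zero comp0d.
Qed.

End Properties.

Lemma transported0 i X Y X' Y' (u : dhom X' (F X)) (w : dhom Y' (F Y)) :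
  transported (i := i) u w (dzero _ _) (dzero _ _).
Proof. by rewrite /transported !compd0 fmap_zero comp0d. Qed.

Lemma transported_id X X' (u : dhom X' (F X)) :
  transported (i := false) u u (did X) (did X').
Proof. by rewrite /transported fmap_id /= !Deq_idl Deq_idr. Qed.

(** Transport respects graded composition: naturality of [xi] moves f past g, and [xi_mu] matches
    the identifications of iterated shifts on both sides. *)
Lemma transported_comp i j l (ijl : i (+) j = l) X Y Z X' Y' Z'
    (u : dhom X' (F X)) (w : dhom Y' (F Y)) (z : dhom Z' (F Z))
    (g : dhom Y (parity_pow A i Z)) (f : dhom X (parity_pow A j Y)) g' f' :
  transported w z g g' -> transported u w f f' ->
  transported u z (parity_comp ijl g f) (parity_comp ijl g' f').
Proof.
rewrite /transported /parity_comp => hg hf.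
rewrite !fmapM -!Deq_compA hf (Deq_compA _ (xi j Y)) -xi_natural.
rewrite -(Deq_compA (xi j _)) (Deq_compA _ (fmap (parity_pow B j) w)) -fmapM hg.
rewrite !fmapM !Deq_compA xi_mu -!Deq_compA.
by rewrite (Deq_compA (fmap (parity_pow B l) z)) -parity_mu_natural !Deq_compA.
Qed.

End Transport.

(** * The regular module in degree n and its right multiplications *)

Lemma concentrated_cmap0 k (A : superalg k) n (X N : cpx A)
    (g : gmap (X n) (N n)) :
  concentrated n N -> (forall j y, cd X j y = 0) ->
  exists q : cmap X N, forall x, q n x = g x.
Proof.
have [m e] : exists m : int, n = m + 1 by exists (n - 1); rewrite subrK.
subst n => hN hX; apply: concentrated_cmap => // y.
by rewrite hX linear0.
Qed.

Section RegularStalk.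
Variables (k : fieldType) (B : superalg k) (n : int).
Implicit Types N : cpx B.

Definition orbit_map (M : gmod B) (y : M) (a : gregular B) : M := gact (a : B) y.

HB.instance Definition _ (M : gmod B) (y : M) :=
  GRing.isLinear.Build k (gregular B) M _ (@orbit_map M y) (@gact_linl _ _ M y).

Lemma orbit_act (M : gmod B) (y : M) (a : B) (v : gregular B) :
  linfun (orbit_map y) (gact a v) = gact a (linfun (orbit_map y) v).
Proof. by rewrite !lfunE /= /orbit_map -gactM. Qed.

Lemma orbit_gr (M : gmod B) (y : M) : y \in ggr M false ->
  forall i (v : gregular B), v \in ggr (gregular B) i ->
  linfun (orbit_map y) v \in ggr M i.
Proof.
by move=> hy i v hv; rewrite lfunE /= /orbit_map -[i]addbF gactG.
Qed.

Definition regstalk := stalk n (gregular B).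
Definition regstalk_one : regstalk n := vsproj _ (sone B : gregular B).
Definition stalk_coef (v : regstalk n) : B := vsval v.

Lemma regstalk_concentrated : concentrated n regstalk.
Proof. exact: stalk_concentrated. Qed.

Lemma stalk_coef_inj : injective stalk_coef.
Proof. exact: subvs_inj. Qed.

Lemma stalk_coef1 : stalk_coef regstalk_one = sone B.
Proof. by rewrite /stalk_coef /regstalk_one vsprojK // mem_stalk_sub. Qed.

Lemma stalk_coef_act a v : stalk_coef (gact a v) = a *s stalk_coef v.
Proof. by rewrite /stalk_coef vsprojK // mem_stalk_sub. Qed.

Lemma stalk_coef_gen v : gact (stalk_coef v) regstalk_one = v.
Proof. by apply: stalk_coef_inj; rewrite stalk_coef_act stalk_coef1 smul1r. Qed.

Lemma stalk_coef_surj b : exists v, stalk_coef v = b.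
Proof. by exists (gact b regstalk_one); rewrite stalk_coef_act stalk_coef1 smul1r. Qed.

Lemma stalk_coefP c v w : stalk_coef (c *: v + w) = c *: stalk_coef v + stalk_coef w.
Proof. exact: (linearP (vsval : subvs_of _ -> _)). Qed.

Lemma stalk_coef_gr v i : (v \in ggr (regstalk n) i) = (stalk_coef v \in sgr B i).
Proof. by rewrite -memv_preim lfunE. Qed.

Lemma regstalk_one_gr : regstalk_one \in ggr (regstalk n) false.
Proof. by rewrite stalk_coef_gr stalk_coef1 Defs.sgr1. Qed.

Lemma regstalk_mapE N (q : cmap regstalk N) v :
  q n v = gact (stalk_coef v) (q n regstalk_one).
Proof. by rewrite -gmap_act stalk_coef_gen. Qed.

(** The regular module is free on 1, so an even y of degree n determines a map; [regstalk_map_eq] is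
    the uniqueness. *)
Lemma regstalk_map_exists N y : concentrated n N -> y \in ggr (N n) false ->
  exists q : cmap regstalk N, q n regstalk_one = y.
Proof.
move=> hN hy.
pose g : gmap (gregular B) (N n) :=
  @Gmap _ _ (gregular B) (N n) (linfun (orbit_map y)) (orbit_act y) (orbit_gr hy).
have [|q hq] := @concentrated_cmap0 _ _ n regstalk N (gcomp g (gsub_incl _)) hN.
  by move=> j v; rewrite zero_lfunE.
exists q; rewrite hq comp_lfunE gsub_inclE lfunE /= /orbit_map.
by rewrite vsprojK; [apply: gact1|apply: (@mem_stalk_sub _ _ n (gregular B))].
Qed.

Lemma regstalk_map_eq N (q q' : cmap regstalk N) :
  concentrated n N -> q n regstalk_one = q' n regstalk_one -> ceq q q'.
Proof.
move=> hN e j v; have [ej|hj] := eqVneq j n; last by rewrite [LHS]hN ?[RHS]hN.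
by subst j; rewrite regstalk_mapE e -regstalk_mapE.
Qed.

(** The image of 1, that is, the element by which r multiplies from the right. *)
Definition rmul_coef i (r : cmap regstalk (parity_pow B i regstalk)) : B :=
  stalk_coef (parity_val i regstalk n (r n regstalk_one)).

Lemma rmul_coef_gr i (r : cmap regstalk (parity_pow B i regstalk)) :
  rmul_coef r \in sgr B i.
Proof.
have := gmap_gr (r n) regstalk_one_gr.
by rewrite parity_val_gr addbF stalk_coef_gr.
Qed.

Lemma rmul_coef_exists i b : b \in sgr B i ->
  exists r : cmap regstalk (parity_pow B i regstalk), rmul_coef r = b.
Proof.
move=> hb; have [v hv] := stalk_coef_surj b.
have [y hy] := @parity_val_surj _ _ i regstalk n v.
have [||r hr] := @regstalk_map_exists (parity_pow B i regstalk) y.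
- exact/parity_pow_concentrated/regstalk_concentrated.
- by rewrite parity_val_gr hy addbF stalk_coef_gr hv.
by exists r; rewrite /rmul_coef hr hy hv.
Qed.

(** Equality in the derived category is equality of chain maps, by [Dmap_faithful], and these are
    determined by the image of 1. *)
Lemma rmul_coef_eq i (r r' : cmap regstalk (parity_pow B i regstalk)) :
  Dmap r ≈ Dmap r' <-> rmul_coef r = rmul_coef r'.
Proof.
have hP := parity_pow_concentrated (i := i) regstalk_concentrated.
split=> [/(Dmap_faithful regstalk_concentrated hP) e|e]; first by rewrite /rmul_coef e.
by apply/Deq_map/regstalk_map_eq/(@parity_val_inj _ _ i)/stalk_coef_inj.
Qed.

(** The order is reversed because r and s are right multiplications. *)
Lemma rmul_coef_comp i j l (ijl : i (+) j = l)
    (r : cmap regstalk (parity_pow B i regstalk))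
    (s : cmap regstalk (parity_pow B j regstalk)) :
  exists2 t, parity_comp ijl (Dmap r) (Dmap s) ≈ Dmap t &
    rmul_coef t = rmul_coef s *s rmul_coef r.
Proof.
have [t [e ht]] := parity_comp_Dmap ijl r s; exists t => //.
by rewrite /rmul_coef ht regstalk_mapE parity_val_act stalk_coef_act.
Qed.

Lemma rmul_coefP i c (r s : cmap regstalk (parity_pow B i regstalk)) :
  rmul_coef (cadd (cscale c r) s) = c *: rmul_coef r + rmul_coef s.
Proof. by rewrite /rmul_coef /= add_lfunE scale_lfunE linearP; apply: stalk_coefP. Qed.

Lemma rmul_coef0 i : rmul_coef (czero regstalk (parity_pow B i regstalk)) = 0.
Proof. by rewrite /rmul_coef zero_lfunE linear0. Qed.

Lemma rmul_coefZ i c (r : cmap regstalk (parity_pow B i regstalk)) :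
  rmul_coef (cscale c r) = c *: rmul_coef r.
Proof.
have := rmul_coefP c r (czero _ _); rewrite rmul_coef0 addr0 => <-.
by rewrite /rmul_coef /= add_lfunE zero_lfunE addr0.
Qed.

End RegularStalk.

(** * The correspondence between central elements of A and of B *)

Section Relation.
Variables (k : fieldType) (A B : superalg k) (F : dfunctor A B).
Variables (S : pi_structure F) (G : dfunctor B A) (FG : quasi_inverse F G).
Variables (n : int) (X : cpx A) (u : dhom (regstalk B n) (F X)) (u_iso : is_iso u).

(* F carries twisted multiplication by x on X to right multiplication by b on the
   stalk, through the isomorphism u. *)
Definition related e i (x : A) (b : B) : Prop :=
  exists (hx : super_central e i x)
         (r : cmap (regstalk B n) (parity_pow B i (regstalk B n))),
    transported S u u (Dmap (twist_mul hx X)) (Dmap r) /\ rmul_coef r = b.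

(** Recognises sums, multiples and composites of twisted multiplications, and removes the dependence
    on the proof of centrality. *)
Lemma twist_mul_unique e i x (hx : super_central e i x) (Y : cpx A)
    (g : cmap Y (parity_pow A i Y)) :
  (forall m j v, v \in ggr (Y m) j ->
     parity_val i Y m (g m v) = (-1) ^+ ((i (+) e) && j) *: gact x v) ->
  Dmap g ≈ Dmap (twist_mul hx Y).
Proof.
move=> h; apply: Deq_map => m; apply: (gr_ind (ggr_dec (Y m))) => [j v hv|v w hv hw].
  by apply: (@parity_val_inj _ _ i); rewrite (h _ _ _ hv) (twist_mulE hx hv).
by rewrite !linearD /= hv hw.
Qed.

Lemma super_central_lin e i c x y :
  super_central (A := A) e i x -> super_central e i y ->
  super_central e i (c *: x + y).
Proof.
move=> [hx cx] [hy cy]; split=> [|j z hz]; first by rewrite memvD ?memvZ.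
rewrite smulDl smulZl smulDr smulZr (cx _ _ hz) (cy _ _ hz).
by rewrite scalerDr !scalerA mulrC.
Qed.

Lemma super_centralM e i x e' i' x' :
  super_central (A := A) e i x -> super_central e' i' x' ->
  super_central (e (+) e') (i (+) i') (x *s x').
Proof.
move=> [hx cx] [hx' cx']; split=> [|j y hy]; first exact: Defs.sgrM.
rewrite -smulA (cx' _ _ hy) smulZr smulA (cx _ _ hy) smulZl scalerA -signr_addb smulA.
congr (_ ^+ nat_of_bool _ *: _).
by case: j {hy}; case: (i) (e) (i') (e') => [] [] [] [].
Qed.

Lemma super_central1 : super_central (A := A) false false (sone A).
Proof.
by split=> [|j y hy]; [exact: Defs.sgr1|rewrite smul1l smul1r scale1r].
Qed.

(** The transported map is a priori only a derived morphism; [Dmap_full] turns it into a chain map,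
    hence a right multiplication. *)
Lemma related_total e i x : super_central e i x -> exists b, related e i x b.
Proof.
move=> hx; have [h hh] := transported_exists S u u_iso (Dmap (twist_mul hx X)).
have hR := @regstalk_concentrated _ B n.
have [r hr] := Dmap_full h hR (parity_pow_concentrated (i := i) hR).
exists (rmul_coef r), hx, r; split=> //.
exact: (transported_deq (Deq_refl _) hr hh).
Qed.

Lemma relatedP e i c x b x' b' :
  related e i x b -> related e i x' b' -> related e i (c *: x + x') (c *: b + b').
Proof.
move=> [hx [r [hr <-]]] [hx' [r' [hr' <-]]]; exists (super_central_lin c hx hx').
exists (cadd (cscale c r) r'); split; last exact: rmul_coefP.
apply: (transported_deq (i := i) _ _ (transportedD (transportedZ c hr) hr')).
  rewrite -Deq_mapZ -Deq_mapD; apply: twist_mul_unique => m j v hv.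
  rewrite add_lfunE scale_lfunE linearP /= !(twist_mulE _ hv) gact_Dl gact_Zl.
  by rewrite scalerDr !scalerA mulrC.
by rewrite Deq_mapD Deq_mapZ.
Qed.

Lemma related_unique e i x b b' : related e i x b -> related e i x b' -> b = b'.
Proof.
move=> [hx [r [hr <-]]] [hx' [r' [hr' <-]]]; apply/rmul_coef_eq.
apply: (transported_unique u_iso hr).
apply: (transported_deq _ (Deq_refl _) hr').
by apply: twist_mul_unique => m j v hv; apply: twist_mulE.
Qed.

(** Right multiplication by any homogeneous c comes from some t on X by fullness. Transporting the
    graded naturality of the twist against t gives the commutation of b with c, with the same
    sign. *)
Lemma related_super_central e i x b : related e i x b -> super_central e i b.
Proof.
move=> [hx [r [hr <-]]]; split=> [|j c hc]; first exact: rmul_coef_gr.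
have [rc <-] := rmul_coef_exists n hc.
have [t ht] := transported_full S u FG u_iso (Dmap rc).
have h1 := transported_comp (erefl (j (+) i)) ht hr.
have h2 := transportedZ ((-1) ^+ ((i (+) e) && j)) (transported_comp (addbC i j) hr ht).
have [t1 e1 <-] := rmul_coef_comp (erefl (j (+) i)) rc r.
have [t2 e2 <-] := rmul_coef_comp (addbC i j) r rc.
rewrite -rmul_coefZ; apply/rmul_coef_eq; rewrite Deq_mapZ -e1 -e2.
apply: (transported_unique u_iso h1).
apply: (transported_deq _ (Deq_refl _) h2).
by rewrite (parity_comp_twist_mul hx (erefl (j (+) i)) (addbC i j)).
Qed.

Lemma relatedM e i x b e' i' x' b' :
  related e i x b -> related e' i' x' b' ->
  related (e (+) e') (i (+) i') (x *s x') (b *s b').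
Proof.
move=> hb hb'; have [_ cb] := related_super_central hb.
case: hb hb' cb => [hx [r [hr <-]]] [hx' [r' [hr' <-]]] cb.
exists (super_centralM hx hx').
have [t et rt] := rmul_coef_comp (erefl (i (+) i')) r r'.
have [h [eh vh]] := parity_comp_Dmap (erefl (i (+) i'))
  (twist_mul hx X) (twist_mul hx' X).
(* Composing the twists by x and x' gives c times the twist by their product, since x' v has degree
   i' + |v|. In B the composite has coefficient b' b, and b b' = c b' b by centrality. *)
pose c : k := (-1) ^+ ((i (+) e) && i').
exists (cscale c t); split; last by rewrite rmul_coefZ rt (cb _ _ (rmul_coef_gr _)).
have := transportedZ c (transported_comp (erefl (i (+) i')) hr hr').
apply: transported_deq; last by rewrite et Deq_mapZ.
rewrite eh -Deq_mapZ; apply: twist_mul_unique => m j v hv.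
rewrite scale_lfunE linearZ /= vh.
have hv' : parity_val i' X m (twist_mul hx' X m v) \in ggr (X m) (i' (+) j).
  by rewrite -parity_val_gr gmap_gr.
rewrite (twist_mulE hx hv') (twist_mulE hx' hv) gactZ -gactM !scalerA -!signr_addb.
congr (_ ^+ nat_of_bool _ *: _).
by case: (j) (i) (e) (i') (e') => [] [] [] [] [].
Qed.

Lemma related1 : related false false (sone A) (sone B).
Proof.
exists super_central1, (cid (regstalk B n)); split; last first.
  by rewrite /rmul_coef /= !id_lfunE stalk_coef1.
apply: transported_deq (transported_id S u); last exact: Deq_refl.
apply: twist_mul_unique => m j v hv.
by rewrite /= !id_lfunE gact1 scale1r.
Qed.

(** If b = 0, the twist vanishes at X. Every homogeneous element of Y is the image of 1 under a map
    from the stalk, so the transported twist at the regular module of A is tested against maps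
    coming from X, where it vanishes by naturality. Evaluating at 1 gives x = 0. *)
Lemma related_inj e i x (Y : cpx B) (w : dhom Y (F (cstalk (gregular A)))) :
  is_iso w -> concentrated n Y -> related e i x 0 -> x = 0.
Proof.
set A0 := cstalk _ => w_iso hY [hx [r [hr r0]]].
have etaX0 : Dmap (twist_mul hx X) ≈ dzero _ _.
  apply: (transported_faithful FG u_iso); apply: transported_deq hr => //.
  by apply/rmul_coef_eq; rewrite rmul_coef0.
have [h hh] := transported_exists S w w_iso (Dmap (twist_mul hx A0)).
have hPY j := parity_pow_concentrated (i := j) hY.
have [h' eh] := Dmap_full h hY (hPY i).
have {}hh := transported_deq (Deq_refl _) eh hh.
have h'0 : Dmap h' ≈ dzero _ _.
  apply: Deq_map => m y; rewrite zero_lfunE.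
  have [em|hm] := eqVneq m n; last by rewrite [LHS]hPY.
  subst m; move: y; apply: (gr_ind (ggr_dec (Y n))) => [j y hy|y z hy hz]; last first.
    by rewrite linearD /= hy hz addr0.
  have [y' hy'] := @parity_val_surj _ _ j Y n y.
  have [q hq] : exists q : cmap (regstalk B n) (parity_pow B j Y),
      q n (regstalk_one B n) = y'.
    by apply: regstalk_map_exists => //; rewrite parity_val_gr hy' addbF.
  have [t ht] := transported_full S w FG u_iso (Dmap q).
  have ij := addbC i j.
  (* Up to sign this composite is t after the twist at X, which is zero. *)
  have e0 : parity_comp ij (Dmap (twist_mul hx A0)) t ≈ dzero _ _.
    have := parity_comp_twist_mul hx erefl ij t; rewrite etaX0 parity_comp0.
    move=> /(Deq_scale ((-1) ^+ ((i (+) e) && j))).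
    by rewrite scaled0 Deq_scaleA -signr_addb addbb Deq_scale1 => <-.
  have h0 := transported_deq e0 (Deq_refl _) (transported_comp ij hh ht).
  have [p [ep vp]] := parity_comp_Dmap ij h' q.
  have p0 : Dmap p ≈ Dmap (czero _ _).
    rewrite -ep; apply: (transported_unique w_iso h0); exact: transported0.
  have := Dmap_faithful (@regstalk_concentrated _ B n) (hPY _) p0 (regstalk_one B n).
  rewrite zero_lfunE => p1; apply: (@parity_val_inj _ _ i).
  by rewrite linear0 -hy' -hq -vp p1 linear0.
have A0_conc : concentrated 0 A0.
  by move=> j /negPf hj; rewrite /A0 /= /cstalk_ob hj => y; apply: thinmx0.
have etaA0 : Dmap (twist_mul hx A0) ≈ dzero _ _.
  apply: (transported_faithful FG w_iso).
  exact: (transported_deq (Deq_refl _) h'0 hh).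
have := Dmap_faithful A0_conc (parity_pow_concentrated (i := i) A0_conc) etaA0.
move=> /(_ 0 (sone A)) e0.
have h1 : (sone A : A0 0) \in ggr (A0 0) false by exact: Defs.sgr1.
have := twist_mulE hx h1; rewrite e0 zero_lfunE linear0 andbF scale1r /=.
by rewrite smul1r.
Qed.

End Relation.

(** A linear relation that is total on U contains the graph of a linear map on U: choose values on a
    basis. *)
Lemma linear_choice (k : fieldType) (V W : vectType k) (U : {vspace V})
    (R : V -> W -> Prop) :
  (forall x, x \in U -> exists y, R x y) ->
  (forall c x y x' y', R x y -> R x' y' -> R (c *: x + x') (c *: y + y')) ->
  exists f : 'Hom(V, W), forall x, x \in U -> R x (f x).
Proof.
move=> Rtot Rlin.
have R0 : R 0 0.
  have [y hy] := Rtot 0 (mem0v U).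
  by have := Rlin (-1) _ _ _ _ hy hy; rewrite !scaleN1r !addNr.
have /fin_all_exists[y hy] : forall i : 'I_(\dim U), exists y, R (vbasis U)`_i y.
  by move=> i; apply/Rtot/vbasis_mem/mem_nth; rewrite size_tuple.
have [f hf] := linear_of_free (vbasis U) [seq y i | i <- enum 'I_(\dim U)].
have fE (i : 'I_(\dim U)) : f (vbasis U)`_i = y i.
  rewrite -(nth_map _ 0) ?size_tuple // hf ?(basis_free (vbasisP U)) //; last first.
    by rewrite size_map size_enum_ord size_tuple.
  by rewrite (nth_map i) ?size_enum_ord // nth_ord_enum.
exists (linfun f) => x hx; rewrite lfunE /= (coord_vbasis hx) linear_sum.
apply: (big_rec2 (fun x y => R x y)) => // i a b _ hab.
by rewrite linearZ /= fE; apply: Rlin.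
Qed.

(** * The centres *)

Section ExtendedCentre.
Variables (k : fieldType) (A : superalg k).

Definition rsmul (x y : A) : A := y *s x.

HB.instance Definition _ (x : A) :=
  GRing.isLinear.Build k A A _ (@smul k A x) (smul_linr x).
HB.instance Definition _ (x : A) :=
  GRing.isLinear.Build k A A _ (rsmul x) (smul_linl x).

(** Being linear in x as well, it turns the commutation condition into membership in a kernel, which
    gives the centres as subspaces. *)
Definition super_commutator (b : bool) (x : A) : 'End(A) :=
  linfun (smul x) - (linfun (rsmul x) \o gsign (sgr A) b)%VF.

Lemma super_commutatorE b x y :
  super_commutator b x y = x *s y - gsign (sgr A) b y *s x.
Proof. by rewrite add_lfunE opp_lfunE comp_lfunE !lfunE. Qed.

Lemma super_commutator_linear b : linear (super_commutator b).
Proof.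
move=> c x x'; apply/lfunP=> y; rewrite [RHS]add_lfunE scale_lfunE !super_commutatorE.
rewrite [X in X - _](linearP (rsmul y)) linearP /= /rsmul scalerBr.
by rewrite opprD addrACA.
Qed.

HB.instance Definition _ b :=
  GRing.isLinear.Build k A 'End(A) _ (super_commutator b) (super_commutator_linear b).

Definition super_central_space (e i : bool) : {vspace A} :=
  (sgr A i :&: lker (linfun (super_commutator (i (+) e))))%VS.

Lemma super_central_spaceP e i x :
  reflect (super_central e i x) (x \in super_central_space e i).
Proof.
rewrite memv_cap memv_ker lfunE /=; apply: (iffP andP) => [[hx /eqP h]|[hx h]].
  split=> // j y hy; have /lfunP/(_ y) := h; rewrite super_commutatorE zero_lfunE.
  rewrite (gsignE (sgr_dec A) _ hy) => /eqP; rewrite subr_eq0 => /eqP ->.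
  exact: smulZl.
split=> //; apply/eqP/lfunP=> y; rewrite zero_lfunE; move: y.
apply: (gr_ind (sgr_dec A)) => [j y hy|y z hy hz]; last first.
  by rewrite linearD /= hy hz addr0.
rewrite super_commutatorE (gsignE (sgr_dec A) _ hy) (h _ _ hy).
by rewrite smulZl subrr.
Qed.

Definition ext_centre (e : bool) : {vspace A} :=
  (super_central_space e false + super_central_space e true)%VS.

Lemma ext_centreP e z : span_of (super_commuting e) z <-> z \in ext_centre e.
Proof.
split=> [[s [hs]]|/memv_addP[x hx [y hy ->]]].
  apply: subvP; apply/span_subvP => x /hs[i hi hx].
  have : x \in super_central_space e i by apply/super_central_spaceP.
  by apply: subvP; case: (i); [apply: addvSr|apply: addvSl].
have sc i v : v \in super_central_space e i -> super_commuting e v.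
  by move=> /super_central_spaceP[h1 h2]; exists i.
exists [:: x; y]; split.
  by move=> v; rewrite !inE => /orP[] /eqP->; [apply: sc hx|apply: sc hy].
by rewrite memvD // memv_span // !inE eqxx ?orbT.
Qed.

End ExtendedCentre.

(** * Embeddings of the centres and the resulting isomorphisms *)

Section CentreMap.
Variables (k : fieldType) (A B : superalg k) (F : dfunctor A B).
Variables (S : pi_structure F) (G : dfunctor B A) (FG : quasi_inverse F G).

(** The index e is the grading of the external sum by super and anti centre, so one multiplicativity
    condition serves both algebras of the theorem. *)
Definition centre_embedding (f : bool -> 'Hom(A, B)) : Prop :=
  [/\ forall e x, x \in ext_centre A e -> f e x \in ext_centre B e,
      forall e x, x \in ext_centre A e -> f e x = 0 -> x = 0,
      f false (sone A) = sone B &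
      forall e e' x x', x \in ext_centre A e -> x' \in ext_centre A e' ->
        f (e (+) e') (x *s x') = f e x *s f e' x'].

Lemma centre_embedding_exists :
  quasi_concentrated (F (cstalk (gregular A))) -> exists f, centre_embedding f.
Proof.
case=> Y /quasi_isomorphic_iso[v0 /is_iso_sym[w w_iso _]] [n hY].
have [_ [be]] := FG.
(* The object X of the correspondence is G of the stalk, placed in the degree n where F of the
   regular module is concentrated. *)
have [u u_iso] : exists u : dhom (regstalk B n) (F (G (regstalk B n))), is_iso u.
  by have [u ? _] := is_iso_sym (nt_iso be (regstalk B n)); exists u.
have /fin_all_exists[f0 hf0] : forall ei : bool * bool, exists f : 'Hom(A, B),
    forall x, x \in super_central_space A ei.1 ei.2 -> related S u ei.1 ei.2 x (f x).
  move=> [e i]; apply: linear_choice => /=.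
    by move=> x /super_central_spaceP hx; apply: related_total.
  by move=> c x b x' b'; apply: relatedP.
(* The choices for even and odd elements are glued along the homogeneous projections. *)
pose f e : 'Hom(A, B) := (f0 (e, false) \o gproj (sgr A) false)%VF
                          + (f0 (e, true) \o gproj (sgr A) true)%VF.
have fR e i x : x \in super_central_space A e i -> related S u e i x (f e x).
  move=> hx; have := hf0 (e, i) _ hx.
  have [hi _] := super_central_spaceP _ _ _ hx; rewrite add_lfunE !comp_lfunE.
  have o := gproj_other (sgr_dec A) hi; have d := gproj_id (sgr_dec A) hi.
  by case: i {hx hi} o d => /= -> ->; rewrite linear0 ?addr0 ?add0r.
have fC e i x : x \in super_central_space A e i -> f e x \in super_central_space B e i.
  by move=> /fR/(related_super_central FG u_iso)/super_central_spaceP.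
exists f; split.
- move=> e _ /memv_addP[x hx [y hy ->]]; rewrite linearD.
  by rewrite memv_add ?fC.
- move=> e _ /memv_addP[x hx [y hy ->]]; rewrite linearD /= => /eqP.
  rewrite addr_eq0 => /eqP fxy.
  have /super_central_spaceP[fx0 _] := fC _ _ _ hx.
  have /super_central_spaceP[fy1 _] := fC _ _ _ hy.
  (* The map preserves degrees, so the images of the even and odd parts vanish separately and
     [related_inj] applies to each. *)
  have fx : f e x = 0.
    have /is_gradingP[_ h] := sgr_dec B; apply: h => //.
    by rewrite fxy memvN.
  have fy : f e y = 0 by apply/eqP; rewrite -oppr_eq0 -fxy; apply/eqP.
  have := fR _ _ _ hx; rewrite fx => /(related_inj FG u_iso w_iso hY) ->.
  have := fR _ _ _ hy; rewrite fy => /(related_inj FG u_iso w_iso hY) ->.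
  by rewrite addr0.
- have h1 : sone A \in super_central_space A false false.
    exact/super_central_spaceP/super_central1.
  exact: (related_unique u_iso (fR _ _ _ h1) (related1 S u)).
- have fM e i e' i' x x' :
      x \in super_central_space A e i -> x' \in super_central_space A e' i' ->
      f (e (+) e') (x *s x') = f e x *s f e' x'.
    move=> hx hx'; have hR := relatedM FG u_iso (fR _ _ _ hx) (fR _ _ _ hx').
    apply: (related_unique u_iso _ hR); apply: fR; apply/super_central_spaceP.
    by apply: super_centralM; apply/super_central_spaceP.
  move=> e e' _ _ /memv_addP[x hx [y hy ->]] /memv_addP[x' hx' [y' hy' ->]].
  rewrite smulDl !smulDr !linearD /= !smulDl.
  rewrite (fM _ _ _ _ _ _ hx hx') (fM _ _ _ _ _ _ hx hy')
    (fM _ _ _ _ _ _ hy hx') (fM _ _ _ _ _ _ hy hy').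
  exact: addrACA.
Qed.

End CentreMap.

(** Injections in both directions force equal dimensions, so the image of f is everything. *)
Lemma centre_embedding_onto k (A B : superalg k) f g :
  @centre_embedding k A B f -> @centre_embedding k B A g ->
  forall e y, y \in ext_centre B e -> exists2 x, x \in ext_centre A e & f e x = y.
Proof.
have im (C D : superalg k) (h : bool -> 'Hom(C, D)) e : centre_embedding h ->
    (h e @: ext_centre C e <= ext_centre D e)%VS /\
    \dim (h e @: ext_centre C e) = \dim (ext_centre C e).
  case=> hC h0 _ _; split.
    by apply/subvP=> _ /memv_imgP[x hx ->]; apply: hC.
  apply: limg_dim_eq; apply/eqP; rewrite -subv0; apply/subvP=> x.
  by rewrite memv_cap memv_ker memv0 => /andP[hx /eqP /(h0 _ _ hx) ->].
move=> hf hg e y hy.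
have [sf df] := im _ _ _ e hf; have [sg dg] := im _ _ _ e hg.
have : (f e @: ext_centre A e == ext_centre B e)%VS.
  by rewrite eqEdim sf df -dg dimvS.
by move=> /eqP e1; move: hy; rewrite -e1 => /memv_imgP[x hx ->]; exists x.
Qed.

Theorem theorem45 (k : closedFieldType) (char_k : 2%N \notin [pchar k])
    (A B : superalg k)
    (F : tri_pi_functor A B) (strongF : strong_equivalence F)
    (G : tri_pi_functor B A) (strongG : strong_equivalence G)
    (FG : quasi_inverse F G) :
  algebras_isomorphic
    (super_centre (A := A)) (sone A) (@smul k A)
    (super_centre (A := B)) (sone B) (@smul k B) /\
  algebras_isomorphic
    (centre_sum (A := A)) (centre_sum_one A) (@centre_sum_mul k A)
    (centre_sum (A := B)) (centre_sum_one B) (@centre_sum_mul k B).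
Proof.
have emb (C D : superalg k) (H : tri_pi_functor C D) :
    strong_equivalence H -> exists f, @centre_embedding k C D f.
  case=> K [HK hc _]; exact: (centre_embedding_exists (tpf_pi H) HK hc).
have [f hf] := emb _ _ _ strongF; have [g hg] := emb _ _ _ strongG.
have onto := centre_embedding_onto hf hg.
have [fC f0 f1 fM] := hf.
have fI e x y : x \in ext_centre A e -> y \in ext_centre A e -> f e x = f e y -> x = y.
  move=> hx hy h; apply/eqP; rewrite -subr_eq0; apply/eqP/(f0 e).
    by rewrite memvB.
  by rewrite linearB /= h subrr.
split.
  exists (f false); split; [|split; [|split; [|split]]] => //.
  - by move=> x /ext_centreP/fC/ext_centreP.
  - by move=> x y /ext_centreP hx /ext_centreP hy; apply: fI.
  - by move=> y /ext_centreP/onto[x hx <-]; exists x => //; apply/ext_centreP.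
  - by move=> x y /ext_centreP hx /ext_centreP hy; apply: (fM false false).
exists (lpair (f false \o lfst A A) (f true \o lsnd A A))%VF.
have E p : lpair (f false \o lfst A A)%VF (f true \o lsnd A A)%VF p
    = (f false p.1, f true p.2).
  by rewrite lpairE !comp_lfunE lfstE lsndE.
have cs (C : superalg k) (p : C * C) : centre_sum p ->
    p.1 \in ext_centre C false /\ p.2 \in ext_centre C true.
  by case=> /ext_centreP ? /ext_centreP.
split; [|split; [|split; [|split]]].
- by move=> x /cs[h1 h2]; rewrite E; split; apply/ext_centreP/fC.
- move=> [x1 x2] [y1 y2] /cs[h1 h2] /cs[h3 h4]; rewrite !E => -[e1 e2].
  by congr (_, _); [apply: fI e1|apply: fI e2].
- move=> [y1 y2] /cs[/onto[x1 h1 e1] /onto[x2 h2 e2]]; exists (x1, x2).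
    by split; apply/ext_centreP.
  by rewrite E e1 e2.
- by rewrite E /= f1 linear0.
- move=> [x1 x2] [y1 y2] /cs[h1 h2] /cs[h3 h4]; rewrite !E /centre_sum_mul /=.
  (* Since [true (+) true] computes to [false], products of two anti-central elements fall under
     [f false]. *)
  rewrite !linearD /= (fM _ _ _ _ h1 h3) -(fM _ _ _ _ h2 h4).
  by rewrite -(fM _ _ _ _ h1 h4) -(fM _ _ _ _ h2 h3).
Qed.
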